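(* Let $n\ge 3$ and let $\Omega\subset\mathbb{R}^n$ be a flexible domain. Let $M$ be an open conformal surface, $U\subset M$ an open set, $K\subset U$ a compact set which is Runge in $M$, $A=\{a_k\}_{k\in\mathbb{N}}$ a closed discrete set in $M$ contained in $U$, and $f:U\to\Omega$ a conformal harmonic immersion. Then for every $\epsilon>0$ and every choice of $m_k\in\mathbb{N}$ $(k\in\mathbb{N})$ there is a conformal minimal immersion $\tilde f:M\to\Omega$ which agrees with $f$ to order $m_k$ at $a_k$ for every $k\in\mathbb{N}$ and satisfies $\sup_{p\in K}|f(p)-\tilde f(p)|<\epsilon$.
   Context: A conformal surface is a topological surface (orientable or not) with an atlas whose transition maps are conformal diffeomorphisms between plane domains, i.e. holomorphic or antiholomorphic; it is open if it has no boundary and no compact connected component. A compact set $K\subset M$ is Runge in $M$ if $M\setminus K$ has no relatively compact connected components. An immersion $f:M\to\mathbb{R}^n$ is a conformal minimal immersion if and only if it is a conformal harmonic immersion; the two terms are used interchangeably. Two maps agree to order $m$ at a point if they have the same $m$-jet there. Flexibility: a connected open domain $\Omega\subset\mathbb{R}^n$, $n\ge 3$, is flexible (for immersed minimal surfaces) if for any open conformal surface $M$, compact Runge set $K\subset M$, finite set $A\subset K$, and conformal harmonic immersion $f:U\to\Omega$ from an open neighbourhood $U$ of $K$, there is for every $\epsilon>0$ and $m\in\mathbb{N}$ a conformal harmonic immersion $\tilde f:M\to\Omega$ which agrees with $f$ to order $m$ at every point of $A$ and satisfies $\sup_{p\in K}|\tilde f(p)-f(p)|<\epsilon$. *)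

(* Defs.v *)
From HB Require Import structures.
From mathcomp Require Import all_boot all_order all_algebra.
From mathcomp Require Import all_classical all_reals all_analysis.

Set Implicit Arguments.
Unset Strict Implicit.
Unset Printing Implicit Defensive.

Import Order.TTheory GRing.Theory Num.Theory.
Import numFieldNormedType.Exports.

Local Open Scope classical_set_scope.
Local Open Scope ring_scope.

(* MathComp-Analysis norms 'rV_n by the sup norm (same topology); the metric
   notions below use the Euclidean structure. *)
Section Euclidean.
Context {R : realType} {n : nat}.

Definition dot (u v : 'rV[R]_n) : R := \sum_i u 0 i * v 0 i.

Definition enorm (u : 'rV[R]_n) : R := Num.sqrt (dot u u).

Definition domain (Omega : set 'rV[R]_n) : Prop :=
  [/\ open Omega, connected Omega & Omega !=set0].

End Euclidean.

(* The plane R^2 is R * R; it is identified with C through (x, y) = x + iy. *)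
Section Plane.
Context {R : realType}.
Implicit Types (F : R * R -> R * R) (z : R * R).

Definition e_x : R * R := (1, 0).
Definition e_y : R * R := (0, 1).

(* multiplication by i *)
Definition mul_i (v : R * R) : R * R := (- v.2, v.1).

Definition holomorphic_near F z : Prop :=
  \forall w \near z, differentiable F w /\
    forall v, 'd F w (mul_i v) = mul_i ('d F w v).

Definition antiholomorphic_near F z : Prop :=
  \forall w \near z, differentiable F w /\
    forall v, 'd F w (mul_i v) = - mul_i ('d F w v).

End Plane.

Section PlaneMaps.
Context {R : realType} {W : normedModType R}.
Implicit Types (g : R * R -> W) (D : set (R * R)) (z : R * R).

(* C^k on the open set D *)
Fixpoint Ck_on (k : nat) D g : Prop :=
  (forall z, D z -> {for z, continuous g}) /\
  if k is k'.+1 then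
    [/\ forall z, D z -> derivable g z e_x /\ derivable g z e_y,
        Ck_on k' D ('D_e_x g) & Ck_on k' D ('D_e_y g)]
  else True.

Definition laplacian g : R * R -> W :=
  'D_e_x ('D_e_x g) \+ 'D_e_y ('D_e_y g).

Definition harmonic_on D g : Prop :=
  Ck_on 2 D g /\ forall z, D z -> laplacian g z = 0.

(* partial derivative of order i in x and j in y *)
Definition partial (i j : nat) g : R * R -> W :=
  iter i (fun h => 'D_e_x h) (iter j (fun h => 'D_e_y h) g).

Definition same_jet (m : nat) g1 g2 z : Prop :=
  forall i j, (i + j <= m)%N -> partial i j g1 z = partial i j g2 z.

Definition immersive_at g z : Prop := injective ('d g z).

End PlaneMaps.

Definition conformal_at {R : realType} {n : nat} (g : R * R -> 'rV[R]_n)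
    (z : R * R) : Prop :=
  dot ('D_e_x g z) ('D_e_y g z) = 0 /\ enorm ('D_e_x g z) = enorm ('D_e_y g z).

(* A homeomorphism from the open set chart_dom of M onto an open set of the
   plane; outside chart_dom and its image, chart_map and chart_inv take
   arbitrary values. *)
Record chart (R : realType) (M : topologicalType) := Chart {
  chart_dom : set M;
  chart_map :> M -> R * R;
  chart_inv : R * R -> M;
  chart_dom_open : open chart_dom;
  chart_img_open : open (chart_map @` chart_dom);
  chart_mapK : forall p, chart_dom p -> chart_inv (chart_map p) = p;
  chart_map_continuous :
    forall p, chart_dom p -> {for p, continuous chart_map};
  chart_inv_continuous :
    forall z, (chart_map @` chart_dom) z -> {for z, continuous chart_inv} }.

(* Transition maps are holomorphic or antiholomorphic near each point: on a
   disconnected overlap the choice may depend on the component. Exchanging phi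
   and psi gives the same property for their inverses. Charts take values in
   open sets of the plane, so there is no boundary. *)
Record conformal_surface (R : realType) := ConformalSurface {
  surface_space :> topologicalType;
  atlas : set (chart R surface_space);
  surface_hausdorff : hausdorff_space surface_space;
  surface_second_countable : @second_countable surface_space;
  atlas_cover :
    forall p : surface_space, exists2 phi, atlas phi & chart_dom phi p;
  atlas_conformal : forall phi psi, atlas phi -> atlas psi ->
    forall z, (phi @` (chart_dom phi `&` chart_dom psi)) z ->
      holomorphic_near (psi \o chart_inv phi) z \/
      antiholomorphic_near (psi \o chart_inv phi) z }.

Definition open_surface {R : realType} (M : conformal_surface R) : Prop :=
  forall p : M, ~ compact (connected_component [set: M] p).

Definition runge {T : topologicalType} (K : set T) : Prop :=
  forall p, (~` K) p -> ~ precompact (connected_component (~` K) p).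

Definition closed_discrete {T : topologicalType} (A : set T) : Prop :=
  closed A /\ isolated A = A.

Section Immersions.
Context {R : realType} {M : conformal_surface R} {n : nat}.
Implicit Types (U : set M) (f : M -> 'rV[R]_n) (Omega : set 'rV[R]_n).

(* Maps defined on an open set U only are represented by total functions,
   whose values off U are irrelevant. *)
Definition conformal_harmonic_immersion U Omega f : Prop :=
  f @` U `<=` Omega /\
  forall phi, atlas phi ->
    let D := phi @` (chart_dom phi `&` U) in
    let g := f \o chart_inv phi in
    harmonic_on D g /\
    forall z, D z -> immersive_at g z /\ conformal_at g z.

Definition agree_to_order (m : nat) f1 f2 (p : M) : Prop :=
  forall phi, atlas phi -> chart_dom phi p ->
    same_jet m (f1 \o chart_inv phi) (f2 \o chart_inv phi) (phi p).

(* The supremum is taken in the extended reals, where the supremum of an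
   unbounded set is +oo. *)
Definition sup_dist (K : set M) f1 f2 : \bar R :=
  ereal_sup [set (enorm (f1 p - f2 p))%:E | p in K].

End Immersions.

Definition flexible {R : realType} {n : nat} (Omega : set 'rV[R]_n) : Prop :=
  domain Omega /\
  forall (M : conformal_surface R) (K A U : set M) (f : M -> 'rV[R]_n),
    open_surface M -> compact K -> runge K -> finite_set A -> A `<=` K ->
    open U -> K `<=` U -> conformal_harmonic_immersion U Omega f ->
    forall (eps : R) (m : nat), 0 < eps ->
    exists ft : M -> 'rV[R]_n,
      [/\ conformal_harmonic_immersion setT Omega ft,
          forall p, A p -> agree_to_order m ft f p &
          (sup_dist K ft f < eps%:E)%E].

(* Main.v *)
Require Import Defs.
From HB Require Import structures.
From mathcomp Require Import all_boot all_order all_algebra.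
From mathcomp Require Import all_classical all_reals all_analysis.
From mathcomp Require Import ring lra.
Import Order.TTheory GRing.Theory Num.Theory.
Import numFieldNormedType.Exports.
Local Open Scope classical_set_scope.
Local Open Scope ring_scope.

Set Implicit Arguments.
Unset Strict Implicit.
Unset Printing Implicit Defensive.

(** The map is built as a limit of conformal harmonic immersions g_0 = f, g_1,
    g_2, ... along an exhaustion K = K_0, K_1, ... of M by compact Runge sets, each
    in the interior of the next ([compact_exhaustion]).  Given g_j near K_j, let F
    be g_j near K_j and f near the finitely many points a_k that lie in K_(j+1) but
    not in K_j.  The union of K_j and of these points is still Runge
    ([runge_finite]), so flexibility yields g_(j+1) on M, close to F on K_j and with
    the prescribed jets ([approximation_step]).  The tolerances are at least
    halved at each step, so the sequence converges uniformly on every K_j.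

    The limit has to be harmonic, conformal, immersive, with values in Omega and
    with the right jets.  This rests on the convergence of derivatives of all
    orders, hence on interior estimates for harmonic functions of the plane that
    are only assumed of class C^2.  These are obtained from the maximum principle
    alone, without integrals:
    - comparison of an odd reflection with a quadratic barrier bounds the gradient
      by the sup norm ([gradient_estimate]);
    - the same estimate applied to difference quotients bounds the second
      derivatives ([harmonic_hessian]);
    - so locally uniform limits of harmonic functions are harmonic, with
      convergence of first derivatives ([harmonic_limit]);
    - a derivative is a limit of harmonic difference quotients, so it is harmonic
      ([harmonic_derive]), and iteration handles all orders ([partial_limit]).

    Harmonicity, conformality and jets are closed conditions and pass to the limit.
    Being an immersion and having values in Omega are open conditions: each g_j
    tolerates a uniform perturbation of some size on K_j ([immersion_stable],
    [image_stable]), and the tolerances are chosen below these sizes. *)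

(** * Derivatives along lines and a strict maximum principle *)

Lemma nbhs_dist (R : realType) (V : normedModType R) (z : V) (A : set V) :
  nbhs z A <-> exists2 r : R, 0 < r & forall w, `|w - z| < r -> A w.
Proof.
split=> [/nbhs_ballP[r r0 rA]|[r r0 rA]].
  by exists r => // w wz; apply: rA; rewrite -ball_normE /= distrC.
apply/nbhs_ballP; exists r => // w; rewrite -ball_normE /= distrC; exact: rA.
Qed.

Section Line.
Context {R : realType} {V W : normedModType R}.

Lemma line_growth (u : V -> W) p e s :
  (fun h : R => h^-1 *: (((fun t : R => u (p + t *: e)) \o shift s) (h *: (1:R)) - u
    (p + s *: e)))
  = (fun h : R => h^-1 *: ((u \o shift (p + s *: e)) (h *: e) - u (p + s *: e))).
Proof.
apply/funext => h /=; congr (_ *: (u _ - _)).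
by rewrite [h%:A]mulr1 scalerDl addrCA.
Qed.

Lemma is_derive_line (u : V -> W) p e s :
  derivable u (p + s *: e) e ->
  is_derive (s : R) 1 (fun t : R => u (p + t *: e)) ('D_e u (p + s *: e)).
Proof.
by move=> du; apply: DeriveDef; rewrite /derivable /derive line_growth.
Qed.

(** Derivatives along a line are used and established in this epsilon form,
    which combines well with explicit inequalities. *)
Lemma derive_approx (u : V -> W) z e (eta : R) : derivable u z e -> 0 < eta ->
  exists2 r : R, 0 < r & forall h, `|h| < r ->
    `|u (z + h *: e) - u z - h *: 'D_e u z| <= eta * `|h|.
Proof.
move=> /cvgrPdist_le /(_ eta) + eta0 => /(_ eta0)[r /= r0 rP].
exists r => // h hr; have [->|h0] := eqVneq h 0.
  by rewrite !scale0r addr0 !subrr !normr0 mulr0.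
have := rP h; rewrite /= sub0r normrN => /(_ hr h0).
rewrite (addrC (h *: e)) => H.
have -> : u (z + h *: e) - u z - h *: 'D_e u z =
    - (h *: ('D_e u z - h^-1 *: (u (z + h *: e) - u z))).
  by rewrite scalerBr scalerA divff // scale1r opprB.
by rewrite normrN normrZ mulrC ler_wpM2r.
Qed.

Lemma is_derive_approx (u : V -> W) z e l :
  (forall eta : R, 0 < eta -> exists2 r : R, 0 < r & forall h, `|h| < r ->
    `|u (z + h *: e) - u z - h *: l| <= eta * `|h|) ->
  is_derive z e u l.
Proof.
move=> H.
have L : (fun h : R => h^-1 *: ((u \o shift z) (h *: e) - u z)) @ 0^' --> l.
  apply/cvgrPdist_le => eta eta0; have [r r0 rP] := H _ eta0.
  exists r => // h; rewrite /= sub0r normrN => hr h0.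
  rewrite (addrC (h *: e)).
  have -> : l - h^-1 *: (u (z + h *: e) - u z) =
      - (h^-1 *: (u (z + h *: e) - u z - h *: l)).
    by rewrite [in RHS]scalerBr scalerA mulVf // scale1r opprB.
  by rewrite normrN normrZ normfV ler_pdivrMl ?normr_gt0 // mulrC; exact: rP.
apply: DeriveDef; first by apply/cvg_ex; exists l.
by apply/cvg_lim => //; exact: norm_hausdorff.
Qed.

End Line.

Section Scalar.
Context {R : realType}.
Implicit Types (g : R -> R).

Lemma is_derive1_continuous (g : R -> R) (s l : R) : is_derive s 1 g l -> {for s, continuous g}.
Proof. by move=> [] /derivable1_diffP /differentiable_continuous. Qed.

(** At an interior maximum g' vanishes; if l were positive, g' would be positive
    just to the right of c, and the mean value theorem would give larger values
    of g there. *)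
Lemma second_derivative_test (g g' : R -> R) (a b c l : R) :
  a < c -> c < b ->
  (forall s : R, a < s < b -> is_derive s 1 g (g' s)) ->
  is_derive c 1 g' l ->
  (forall s, a < s < b -> g s <= g c) -> l <= 0.
Proof.
move=> ac cb dg dg' gc; rewrite leNgt; apply/negP => l0.
have cab : c \in `]a, b[%R by rewrite in_itv /= ac cb.
have g'c : g' c = 0.
  have gm : is_derive c 1 g 0.
    apply: (@derive1_at_max _ g a b c (ltW (lt_trans ac cb)) _ cab).
      by move=> t; rewrite in_itv /= => /dg[].
    by move=> t; rewrite in_itv /= => /gc.
  have [_ <-] : is_derive c 1 g (g' c) by apply: dg; rewrite ac.
  by case: gm.
have [dc el] := dg'.
have : (fun h : R => h^-1 *: (g' (h *: (1:R) + c) - g' c)) @ 0^' --> l.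
  by rewrite -el; exact: dc.
move=> /cvgrPdist_lt /(_ l l0)[r /= r0 rP].
set h := Num.min (r / 2) ((b - c) / 2).
have h0 : 0 < h by rewrite lt_min !divr_gt0// subr_gt0.
have hb : c + h < b.
  have : h <= (b - c) / 2 by rewrite ge_min lexx orbT.
  lra.
have hr : h < r by have : h <= r / 2 by [rewrite ge_min lexx]; lra.
have ch : c < c + h by lra.
have [||x] := @MVT R g g' c (c + h) ch.
- by move=> x; rewrite in_itv /= => /andP[cx xh]; apply: dg; apply/andP; split; lra.
- apply: continuous_in_subspaceT => x; rewrite inE /= in_itv /= => /andP[cx xh].
  apply: (@is_derive1_continuous _ _ (g' x)); apply: dg; apply/andP; split; lra.
move=> xin gE; suff: 0 < g' x.
  have := gc (c + h); rewrite hb (lt_trans ac ch) => /(_ isT) gch x0.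
  have : 0 < g' x * (c + h - c) by apply: mulr_gt0 => //; lra.
  by rewrite -gE; lra.
move: xin; rewrite in_itv /= => /andP[cx xh].
have := rP (x - c); rewrite /= sub0r normrN gtr0_norm ?subr_gt0 // => /(_ _) H.
have {}H := H ltac:(lra).
rewrite g'c subr0 [_%:A]mulr1 subrK in H.
have xc : 0 < x - c by lra.
have := H (lt0r_neq0 xc); rewrite ltr_norml => /andP[_].
rewrite ltrBlDl -ltrBlDr subrr /GRing.scale /=.
by rewrite pmulr_rgt0 // invr_gt0.
Qed.

(** An interior maximum is impossible, since both pure second derivatives are
    nonpositive there; so the maximum over the rectangle lies on the boundary. *)
Lemma strict_max_principle (F Fs Ft : R * R -> R) (d : R) : 0 < d ->
  (forall s t, 0 <= s <= d -> - d <= t <= d -> {for (s, t), continuous F}) ->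
  (forall s t, 0 < s < d -> - d < t < d ->
    is_derive (s : R) 1 (fun s' : R => F (s', t) : R) (Fs (s, t)) /\
    is_derive (t : R) 1 (fun t' : R => F (s, t') : R) (Ft (s, t))) ->
  (forall s t, 0 < s < d -> - d < t < d -> exists l1 l2,
    [/\ is_derive (s : R) 1 (fun s' : R => Fs (s', t) : R) l1,
    is_derive (t : R) 1 (fun t' : R => Ft (s, t') : R) l2 & 0 < l1 + l2]) ->
  (forall s t, 0 <= s <= d -> - d <= t <= d ->
    s = 0 \/ s = d \/ t = - d \/ t = d -> F (s, t) <= 0) ->
  forall s t, 0 <= s <= d -> - d <= t <= d -> F (s, t) <= 0.
Proof.
move=> d0 Fc F1 F2 Fb s t s0 t0.
pose B := `[0, d]%classic `*` `[(- d), d]%classic : set (R * R).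
have [||| [c1 c2]] := @compact_EVT_max _ R F B.
- by exists (s, t); split; rewrite /= in_itv.
- by apply: compact_setX; exact: segment_compact.
- apply: continuous_in_subspaceT => -[x y]; rewrite inE => -[/=].
  by rewrite !in_itv /= => xs ys; exact: Fc.
rewrite inE => -[/=]; rewrite !in_itv /= => c1P c2P cmax.
apply: (@le_trans _ _ (F (c1, c2))).
  by apply: cmax; rewrite inE /B; split; rewrite /= in_itv.
have [->|c10] := eqVneq c1 0; first by apply: Fb => //; [rewrite lexx ltW|left].
have [->|c1d] := eqVneq c1 d; first by apply: Fb => //; [rewrite lexx ltW|right;left].
have [->|c2d] := eqVneq c2 (- d).
  by apply: Fb => //; [rewrite lexx /=; lra|right;right;left].
have [->|c2d'] := eqVneq c2 d.
  by apply: Fb => //; [rewrite lexx andbT; lra|right;right;right].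
have {}c1P : 0 < c1 < d.
  by move: c1P => /andP[? ?]; rewrite !lt_neqAle eq_sym c10 c1d; apply/andP.
have {}c2P : - d < c2 < d.
  by move: c2P => /andP[? ?]; rewrite !lt_neqAle eq_sym c2d c2d'; apply/andP.
have [l1 [l2 [d1 d2 l12]]] := F2 _ _ c1P c2P.
case/andP: (c1P) => c1a c1b; case/andP: (c2P) => c2a c2b.
have : l1 <= 0.
  apply: (@second_derivative_test (fun x => F (x, c2)) (fun x => Fs (x, c2)) 0 d c1 l1) =>
    // x xP.
    by case: (F1 x c2 xP c2P).
  by apply: cmax; rewrite inE /B; split; rewrite /= in_itv /=; lra.
have : l2 <= 0.
  apply: (@second_derivative_test (fun x => F (c1, x)) (fun x =>
    Ft (c1, x)) (- d) d c2 l2) => // x xP.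
    by case: (F1 c1 x c1P xP).
  by apply: cmax; rewrite inE /B; split; rewrite /= in_itv /=; lra.
lra.
Qed.

End Scalar.

(** * The gradient estimate *)

Section Gradient.
Context {R : realType} {V : normedModType R}.

Lemma is_derive_lineN (u : V -> R) p e (s : R) :
  derivable u (p - s *: e) e ->
  is_derive s 1 (fun t : R => u (p - t *: e)) (- 'D_e u (p - s *: e)).
Proof.
rewrite -scaleNr => du.
have H := is_derive_line du.
have -> : (fun t : R => u (p - t *: e)) = (fun t : R => u (p + t *: e)) \o -%R.
  by apply/funext => t /=; rewrite scaleNr.
have [d1 d2] := @is_derive1_comp R (fun t : R => u (p + t *: e)) -%R s _ (-1) H _.
by apply: DeriveDef; [exact: d1|rewrite d2 mulrN1].
Qed.

Lemma is_derive_quadratic (f : R -> R) (a b c x : R) :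
  (forall y, f y = a + b * y + c * y ^+ 2) ->
  is_derive x 1 f (b + 2 * c * x).
Proof.
move=> /funext ->.
apply: is_derive_eq.
rewrite /GRing.scale /=; ring.
Qed.

Lemma is_derive_minus_barrier (f g q : R -> R) (c m k x a b l : R) :
  is_derive x 1 f a -> is_derive x 1 g b -> is_derive x 1 q l ->
  is_derive x 1 (fun y => c * (f y + m * g y) - k * q y) (c * (a + m * b) - k * l).
Proof.
by move=> df dg dq; apply: is_derive_eq.
Qed.

(** The pairs (a, b) and (a', b') stand for the two pure second derivatives of a
    harmonic function at two mirror points, c/2 is the weight of the odd
    reflection, and the terms in k come from the barrier. *)
Lemma barrier_laplacian_gt0 (a b a' b' c s t k : R) : a + b = 0 -> a' + b' = 0 -> 0 < k ->
  0 < c / 2 * (a + 1 * - a') - k * (- 4 + 2 * 0 * s) +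
      (c / 2 * (b + -1 * b') - k * (2 + 2 * 0 * t)).
Proof. by move=> /eqP; rewrite addr_eq0 => /eqP-> /eqP; rewrite addr_eq0 => /eqP-> k0; nra. Qed.

(** Here a and b stand for the values of a function at z + h e and z - h e, a0 for
    its value at z and D for its derivative. A slope c D above 3 M / d would lift
    the odd reflection above the barrier at distance h. *)
Lemma barrier_slope (h d M c a a0 b D : R) : 0 < h -> 0 < d ->
  let eta := (c * D - 3 * M / d) / 2 in let k := M / d ^+ 2 in
  c * (b - a0 - - h * D) <= eta * h -> - (eta * h) <= c * (a - a0 - h * D) ->
  c / 2 * (a + -1 * b) - k * (0 ^+ 2 + h * (3 * d - 2 * h)) <= 0 ->
  0 < M -> 3 * M / d < c * D -> False.
Proof.
move=> h0 d0 eta k B1 B2 B3 M0 H.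
pose q := M / d; have q0 : 0 < q by rewrite divr_gt0.
have kE : k = q / d by rewrite /k /q expr2 invfM mulrA.
have MdE : 3 * M / d = 3 * q by rewrite /q mulrA.
have kd : k * (0 ^+ 2 + h * (3 * d - 2 * h)) = 3 * q * h - 2 * (q / d) * h ^+ 2.
  by rewrite kE; field; rewrite gt_eqF.
have p0 : 0 < (q / d) * h ^+ 2 by rewrite mulr_gt0 ?divr_gt0 ?exprn_gt0.
rewrite kd in B3; rewrite /eta MdE in B1 B2; rewrite MdE in H.
have : 0 < (c * D - 3 * q) * h by rewrite mulr_gt0 // subr_gt0.
nra.
Qed.

(** Odd reflection and a barrier. On 0 <= s <= d, |t| <= d the function
    c/2 (u (z + s e + t e') - u (z - s e + t e')) is harmonic, bounded by M and
    zero at s = 0. With k = M/d^2, the barrier k (t^2 + s (3 d - 2 s)) dominates it on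
    the boundary and has Laplacian - 2 k < 0. Comparison at t = 0 as s tends to 0
    bounds the derivative; the two values of c give the two signs. *)
Lemma gradient_estimate_dir (u : V -> R) z e e' (c d M : R) :
  0 < d -> 0 < M -> `|c| = 1 ->
  (forall s t, `|s| <= d -> `|t| <= d -> let w := z + t *: e' + s *: e in
    [/\ {for w, continuous u}, derivable u w e, derivable u w e' & `|u w| <= M] /\
    [/\ derivable ('D_e u) w e, derivable ('D_e' u) w e' &
        'D_e ('D_e u) w + 'D_e' ('D_e' u) w = 0]) ->
  c * 'D_e u z <= 3 * M / d.
Proof.
move=> d0 M0 c1 hu.
pose P (p : R * R) := z + p.2 *: e' + p.1 *: e.
pose N (p : R * R) := z + p.2 *: e' - p.1 *: e.
pose k := M / d ^+ 2.
have k0 : 0 < k by rewrite divr_gt0 // exprn_gt0.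
pose F p := c / 2 * (u (P p) + -1 * u (N p)) - k * (p.2 ^+ 2 + p.1 * (3 * d - 2 * p.1)).
pose Fs p := c / 2 * ('D_e u (P p) + 1 * 'D_e u (N p)) - k * (3 * d - 4 * p.1).
pose Ft p := c / 2 * ('D_e' u (P p) + -1 * 'D_e' u (N p)) - k * (2 * p.2).
have FP : forall s t, 0 <= s <= d -> - d <= t <= d -> F (s, t) <= 0.
  have hP p : 0 <= p.1 <= d -> - d <= p.2 <= d ->
      `|p.1| <= d /\ `|p.2| <= d /\ `|- p.1| <= d.
    by move=> p1 p2; rewrite normrN !ler_norml; split; [|split]; lra.
  have Pc : continuous P.
    move=> p; apply: cvgD; last by apply: cvgZl; exact: cvg_fst.
    by apply: cvgD; [exact: cvg_cst|apply: cvgZl; exact: cvg_snd].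
  have Nc : continuous N.
    move=> p; apply: cvgB; last by apply: cvgZl; exact: cvg_fst.
    by apply: cvgD; [exact: cvg_cst|apply: cvgZl; exact: cvg_snd].
  have PD1 (v : V -> R) s t : derivable v (z + t *: e' + s *: e) e ->
      is_derive s 1 (fun s' : R => v (P (s', t))) ('D_e v (P (s, t))).
    by rewrite /P => v1; have H := is_derive_line v1; exact H.
  have PD2 (v : V -> R) s t : derivable v (z + t *: e' + s *: e) e' ->
      is_derive t 1 (fun t' : R => v (P (s, t'))) ('D_e' v (P (s, t))).
    rewrite /P => v2.
    have E x : z + x *: e' + s *: e = z + s *: e + x *: e' by rewrite addrAC.
    have -> : (fun t' : R => v (z + t' *: e' + s *: e)) = fun t' => v (z + s *: e + t' *: e').
      by apply/funext => x; rewrite E.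
    by move: v2; rewrite /= E => v2; have H := is_derive_line v2; exact H.
  have ND1 (v : V -> R) s t : derivable v (z + t *: e' - s *: e) e ->
      is_derive s 1 (fun s' : R => v (N (s', t))) (- 'D_e v (N (s, t))).
    by rewrite /N => v1; have H := is_derive_lineN v1; exact H.
  have ND2 (v : V -> R) s t : derivable v (z + t *: e' - s *: e) e' ->
      is_derive t 1 (fun t' : R => v (N (s, t'))) ('D_e' v (N (s, t))).
    rewrite /N => v2.
    have E x : z + x *: e' - s *: e = z - s *: e + x *: e' by rewrite addrAC.
    have -> : (fun t' : R => v (z + t' *: e' - s *: e)) = fun t' => v (z - s *: e + t' *: e').
      by apply/funext => x; rewrite E.
    by move: v2; rewrite /= E => v2; have H := is_derive_line v2; exact H.
  have SMP := @strict_max_principle R F Fs Ft d d0.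
  apply SMP => s t sP tP.
  - have [s1 [t1 s2]] := hP (s, t) sP tP.
    have [[uP _ _ _] _] := hu s t s1 t1; have [[uN _ _ _] _] := hu (- s) t s2 t1.
    rewrite scaleNr in uN.
    have cP : {for (s, t), continuous (fun p => u (P p))}.
      by apply: (@continuous_comp _ _ _ P u) => //; exact: Pc.
    have cN : {for (s, t), continuous (fun p => u (N p))}.
      by apply: (@continuous_comp _ _ _ N u) => //; exact: Nc.
    have cq : {for (s, t), continuous (fun p : R * R => p.2 ^+ 2 + p.1 * (3 * d - 2 * p.1))}.
      apply: cvgD; first by apply: cvgM; exact: cvg_snd.
      apply: cvgM; first exact: cvg_fst.
      by apply: cvgB; [exact: cvg_cst|apply: cvgM; [exact: cvg_cst|exact: cvg_fst]].
    rewrite /F; apply: cvgB; apply: cvgM; [exact: cvg_cst| |exact: cvg_cst|exact: cq].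
    by apply: cvgD; [exact: cP|apply: cvgM; [exact: cvg_cst|exact: cN]].
  - have [s1 [t1 s2]] := hP (s, t) ltac:(rewrite /=; lra) ltac:(rewrite /=; lra).
    have [[_ uP1 uP2 _] _] := hu s t s1 t1.
    have [[_ uN1 uN2 _] _] := hu (- s) t s2 t1.
    rewrite scaleNr in uN1 uN2.
    have A1 := PD1 u s t uP1; have A2 := PD2 u s t uP2.
    have B1 := ND1 u s t uN1; have B2 := ND2 u s t uN2.
    split.
      have Q := @is_derive_quadratic (fun x => t ^+ 2 + x * (3 * d - 2 * x))
        (t ^+ 2) (3 * d) (- 2) s ltac:(move=> y; ring).
      have [D1 D2] := is_derive_minus_barrier (c / 2) (-1) k A1 B1 Q.
      apply: DeriveDef => //; rewrite D2 /Fs /=; ring.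
    have Q := @is_derive_quadratic (fun x => x ^+ 2 + s * (3 * d - 2 * s))
      (s * (3 * d - 2 * s)) 0 1 t ltac:(move=> y; ring).
    have [D1 D2] := is_derive_minus_barrier (c / 2) (-1) k A2 B2 Q.
    apply: DeriveDef => //; rewrite D2 /Ft /=; ring.
  - have [s1 [t1 s2]] := hP (s, t) ltac:(rewrite /=; lra) ltac:(rewrite /=; lra).
    have [_ [uP1 uP2 uP]] := hu s t s1 t1.
    have [_ [uN1 uN2 uN]] := hu (- s) t s2 t1.
    rewrite scaleNr in uN1 uN2 uN.
    have A1 := PD1 ('D_e u) s t uP1; have A2 := PD2 ('D_e' u) s t uP2.
    have B1 := ND1 ('D_e u) s t uN1; have B2 := ND2 ('D_e' u) s t uN2.
    have Q1 := @is_derive_quadratic (fun x => 3 * d - 4 * x)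
        (3 * d) (- 4) 0 s ltac:(move=> y; ring).
    have Q2 := @is_derive_quadratic (fun x => 2 * x) 0 2 0 t ltac:(move=> y; ring).
    have D1 := is_derive_minus_barrier (c / 2) 1 k A1 B1 Q1.
    have D2 := is_derive_minus_barrier (c / 2) (-1) k A2 B2 Q2.
    do 2!eexists; split; [exact: D1|exact: D2|].
    have H := barrier_laplacian_gt0 c s t uP uN k0; exact H.
  - have [s1 [t1 s2]] := hP (s, t) sP tP.
    have [[_ _ _ uP] _] := hu s t s1 t1; have [[_ _ _ uN] _] := hu (- s) t s2 t1.
    rewrite scaleNr in uN.
    have kd : M = k * d ^+ 2 by rewrite /k; field; lra.
    have cM : c / 2 * (u (P (s, t)) + -1 * u (N (s, t))) <= M.
      rewrite (le_trans (ler_norm _)) // normrM normrM c1 mul1r gtr0_norm ?invr_gt0 //.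
      rewrite ler_pdivrMl // mulN1r (le_trans (ler_normB _ _)) //.
      by rewrite mulr_natl mulr2n lerD.
    rewrite /F /=; case=> [s0|].
      rewrite s0 /P /N /= scale0r subr0 addr0 mulN1r subrr mulr0 mul0r addr0 sub0r oppr_le0.
      by rewrite mulr_ge0 ?sqr_ge0 // ltW.
    move=> H; suff : M <= k * (t ^+ 2 + s * (3 * d - 2 * s)) by lra.
    rewrite kd ler_pM2l //.
    by case: H => [->|[] ->]; nra.
suff: ~ (3 * M / d < c * 'D_e u z) by move=> /negP; rewrite -leNgt.
move=> H.
have [[_ du _ _] _] := hu 0 0 ltac:(rewrite normr0; lra) ltac:(rewrite normr0; lra).
rewrite !scale0r !addr0 in du.
pose eta := (c * 'D_e u z - 3 * M / d) / 2.
have eta0 : 0 < eta by rewrite divr_gt0 // subr_gt0.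
have [r r0 rP] := derive_approx du eta0.
pose h := Num.min r d / 2.
have h0 : 0 < h by rewrite divr_gt0 // lt_min r0 d0.
have m1 : Num.min r d <= r by rewrite ge_min lexx.
have m2 : Num.min r d <= d by rewrite ge_min lexx orbT.
have hr : h < r by rewrite /h; lra.
have hd : h <= d by rewrite /h; lra.
have := FP h 0 ltac:(lra) ltac:(lra); rewrite /F /P /N /= scale0r addr0.
have := rP h; have := rP (- h).
rewrite normrN gtr0_norm // scaleNr => /(_ hr) B1 /(_ hr) B2.
have {}B1 : `|c * (u (z - h *: e) - u z - - h *: 'D_e u z)| <= eta * h by
  rewrite normrM c1 mul1r.
have {}B2 : `|c * (u (z + h *: e) - u z - h *: 'D_e u z)| <= eta * h by rewrite normrM c1 mul1r.
move: B1 B2; rewrite !ler_norml => /andP[_ B1] /andP[B2 _].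
rewrite /GRing.scale /= in B1 B2.
move=> FF; have X := barrier_slope h0 d0 B1 B2 FF M0 H; exact X.
Qed.

Lemma gradient_estimate (u : V -> R) z e e' (d M : R) :
  0 < d -> 0 < M ->
  (forall s t, `|s| <= d -> `|t| <= d -> let w := z + t *: e' + s *: e in
    [/\ {for w, continuous u}, derivable u w e, derivable u w e' & `|u w| <= M] /\
    [/\ derivable ('D_e u) w e, derivable ('D_e' u) w e' &
        'D_e ('D_e u) w + 'D_e' ('D_e' u) w = 0]) ->
  `|'D_e u z| <= 3 * M / d.
Proof.
move=> d0 M0 hu; rewrite ler_norml; apply/andP; split.
  have := @gradient_estimate_dir u z e e' (-1) d M d0 M0 (normrN1 _) hu.
  by rewrite mulN1r lerNl.
by have := @gradient_estimate_dir u z e e' 1 d M d0 M0 (normr1 _) hu; rewrite mul1r.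
Qed.

End Gradient.

(** * Functions of class C^k and harmonic functions on plane domains *)

Section CkToolkit.
Context {R : realType} {W : normedModType R}.
Implicit Types (g : R * R -> W) (D : set (R * R)) (z : R * R).

(** The boolean index makes axis (~~ b) the direction orthogonal to axis b, so
    that both partial derivatives are treated at once. *)
Definition axis (b : bool) : R * R := if b then e_y else e_x.

Lemma Ck_onS k D g : Ck_on k.+1 D g <->
  (forall z, D z -> {for z, continuous g}) /\
  forall b, (forall z, D z -> derivable g z (axis b)) /\ Ck_on k D ('D_(axis b) g).
Proof.
split=> [[gc [gd gx gy]]|[gc gb]].
  by split => // -[]; split => // z /gd[].
split => //; have [dx cx] := gb false; have [dy cy] := gb true.
by split => // z Dz; split; [exact: dx|exact: dy].
Qed.

Lemma Ck_on_continuous k D g : Ck_on k D g ->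
  forall z, D z -> {for z, continuous g}.
Proof. by case: k => [|k] []. Qed.

Lemma open_eq_near D g1 g2 z : open D -> (forall z, D z -> g1 z = g2 z) ->
  D z -> \forall w \near z, g1 w = g2 w.
Proof. by move=> oD E Dz; move: (open_nbhs_nbhs (conj oD Dz)); apply: filterS. Qed.

Lemma eq_on_derive D g1 g2 b : open D -> (forall z, D z -> g1 z = g2 z) ->
  forall z, D z -> 'D_(axis b) g1 z = 'D_(axis b) g2 z.
Proof. by move=> oD E z Dz; apply: near_eq_derive; exact: open_eq_near oD E Dz. Qed.

Lemma Ck_on_ext k D g1 g2 : open D -> (forall z, D z -> g1 z = g2 z) ->
  Ck_on k D g1 -> Ck_on k D g2.
Proof.
move=> oD; elim: k g1 g2 => [|k IH] g1 g2 E.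
  case=> gc _; split => // z Dz.
  have := gc z Dz; rewrite /prop_for /continuous_at -(E z Dz) => H.
  apply: cvg_trans H; apply: near_eq_cvg.
  exact: open_eq_near oD E Dz.
move=> /Ck_onS[gc gb]; apply/Ck_onS; split.
  move=> z Dz; have := gc z Dz; rewrite /prop_for /continuous_at -(E z Dz) => H.
  by apply: cvg_trans H; apply: near_eq_cvg; exact: open_eq_near oD E Dz.
move=> b; have [gd gC] := gb b; split.
  move=> z Dz; apply: near_eq_derivable (gd z Dz).
  exact: open_eq_near oD E Dz.
apply: IH gC; exact: eq_on_derive.
Qed.

Lemma Ck_on_sub k D D' g : D' `<=` D -> Ck_on k D g -> Ck_on k D' g.
Proof.
move=> DD; elim: k g => [|k IH] g.
  by case=> gc _; split => // z /DD; exact: gc.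
move=> /Ck_onS[gc gb]; apply/Ck_onS; split; first by move=> z /DD; exact: gc.
by move=> b; have [gd gC] := gb b; split; [move=> z /DD; exact: gd|exact: IH].
Qed.

Lemma Ck_on_local k D g :
  (forall z, D z -> exists2 D', D' z & Ck_on k D' g) -> Ck_on k D g.
Proof.
elim: k g => [|k IH] g H.
  by split => // z /H[D' Dz [gc _]]; exact: gc.
apply/Ck_onS; split; first by move=> z /H[D' Dz /Ck_on_continuous]; apply.
move=> b; split; first by move=> z /H[D' Dz /Ck_onS[_ /(_ b)[gd _]]]; exact: gd.
by apply: IH => z /H[D' Dz /Ck_onS[_ /(_ b)[_ ?]]]; exists D'.
Qed.

Lemma shift_growth (g : R * R -> W) a e z :
  (fun h : R => h^-1 *: (((fun z => g (z + a)) \o shift z) (h *: e) - g (z + a))) =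
  (fun h : R => h^-1 *: ((g \o shift (z + a)) (h *: e) - g (z + a))).
Proof. by apply/funext => h /=; rewrite addrA. Qed.

Lemma derive_shiftE (g : R * R -> W) a e :
  'D_e (fun z => g (z + a)) = (fun z => 'D_e g (z + a)).
Proof. by apply/funext => z; rewrite /derive shift_growth. Qed.

Lemma derivable_shift (g : R * R -> W) a e z :
  derivable g (z + a) e -> derivable (fun z => g (z + a)) z e.
Proof. by rewrite /derivable shift_growth. Qed.

Lemma Ck_on_shift k D g a : Ck_on k D g ->
  Ck_on k [set z | D (z + a)] (fun z => g (z + a)).
Proof.
have sc (f : R * R -> W) z : {for (z + a), continuous f} ->
  {for z, continuous (fun z => f (z + a))}.
  move=> fc; apply: (@continuous_comp _ _ _ (fun z => z + a) f) => //.
  by apply: cvgD; [exact: cvg_id|exact: cvg_cst].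
elim: k g => [|k IH] g.
  by case=> gc _; split => // z /gc; exact: sc.
move=> /Ck_onS[gc gb]; apply/Ck_onS; split; first by move=> z /gc; exact: sc.
move=> b; have [gd gC] := gb b; split; first by move=> z /gd; exact: derivable_shift.
rewrite derive_shiftE; have H := IH _ gC; exact H.
Qed.

Lemma Ck_onB k D g1 g2 : open D -> Ck_on k D g1 -> Ck_on k D g2 ->
  Ck_on k D (g1 \- g2).
Proof.
move=> oD; elim: k g1 g2 => [|k IH] g1 g2.
  by move=> [c1 _] [c2 _]; split => // z Dz; apply: cvgB; [exact: c1|exact: c2].
move=> /Ck_onS[c1 b1] /Ck_onS[c2 b2]; apply/Ck_onS; split.
  by move=> z Dz; apply: cvgB; [exact: c1|exact: c2].
move=> b; have [d1 k1] := b1 b; have [d2 k2] := b2 b; split.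
  by move=> z Dz; apply: derivableB; [exact: d1|exact: d2].
apply: (@Ck_on_ext _ _ ('D_(axis b) g1 \- 'D_(axis b) g2)) => //.
  by move=> z Dz /=; rewrite -deriveB; [|exact: d1|exact: d2].
exact: IH.
Qed.

Lemma Ck_onZ k D g (c : R) : open D -> Ck_on k D g -> Ck_on k D (c \*: g).
Proof.
move=> oD; elim: k g => [|k IH] g.
  by move=> [c1 _]; split => // z Dz; apply: cvgZr; exact: c1.
move=> /Ck_onS[c1 b1]; apply/Ck_onS; split.
  by move=> z Dz; apply: cvgZr; exact: c1.
move=> b; have [d1 k1] := b1 b; split.
  by move=> z Dz; apply: derivableZ; exact: d1.
apply: (@Ck_on_ext _ _ (c \*: 'D_(axis b) g)) => //.
  by move=> z Dz /=; rewrite -deriveZ //; exact: d1.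
exact: IH.
Qed.

Lemma laplacianE b g z : laplacian g z =
  'D_(axis b) ('D_(axis b) g) z + 'D_(axis (~~ b)) ('D_(axis (~~ b)) g) z.
Proof.
case: b; last by [].
have H := addrC ('D_(axis true) ('D_(axis true) g) z)
  ('D_(axis false) ('D_(axis false) g) z).
by symmetry; exact H.
Qed.

Lemma Ck2_derivable D g b b' : Ck_on 2 D g -> forall z, D z ->
  [/\ derivable g z (axis b), {for z, continuous ('D_(axis b) g)},
      derivable ('D_(axis b) g) z (axis b') &
      {for z, continuous ('D_(axis b') ('D_(axis b) g))}].
Proof.
move=> /Ck_onS[_ /(_ b)[gd /Ck_onS[gc /(_ b')[gdd gC]]]] z Dz.
by split; [exact: gd|exact: gc|exact: gdd|exact: Ck_on_continuous gC _ Dz].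
Qed.

Lemma harmonic_onB D g1 g2 : open D -> harmonic_on D g1 -> harmonic_on D g2 ->
  harmonic_on D (g1 \- g2).
Proof.
move=> oD [c1 l1] [c2 l2]; split; first exact: Ck_onB.
have H b z : D z -> 'D_(axis b) ('D_(axis b) (g1 \- g2)) z =
    'D_(axis b) ('D_(axis b) g1) z - 'D_(axis b) ('D_(axis b) g2) z.
  move=> Dz.
  have E w : D w -> 'D_(axis b) (g1 \- g2) w = ('D_(axis b) g1 - 'D_(axis b) g2) w.
    move=> Dw; have [? _ _ _] := Ck2_derivable b b c1 Dw.
    by have [? _ _ _] := Ck2_derivable b b c2 Dw; rewrite deriveB.
  rewrite (eq_on_derive b oD E Dz).
  have [_ _ ? _] := Ck2_derivable b b c1 Dz.
  by have [_ _ ? _] := Ck2_derivable b b c2 Dz; rewrite deriveB.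
move=> z Dz; rewrite /laplacian /=.
have := H false z Dz; rewrite /axis => ->; have := H true z Dz; rewrite /axis => ->.
rewrite addrACA -opprD.
have := l1 z Dz; rewrite /laplacian /= => ->.
by have := l2 z Dz; rewrite /laplacian /= => ->; rewrite subrr.
Qed.

Lemma harmonic_onZ D g (c : R) : open D -> harmonic_on D g ->
  harmonic_on D (c \*: g).
Proof.
move=> oD [c1 l1]; split; first exact: Ck_onZ.
have H b z : D z -> 'D_(axis b) ('D_(axis b) (c \*: g)) z =
    c *: 'D_(axis b) ('D_(axis b) g) z.
  move=> Dz.
  have E w : D w -> 'D_(axis b) (c \*: g) w = (c \*: 'D_(axis b) g) w.
    by move=> Dw; have [? _ _ _] := Ck2_derivable b b c1 Dw; rewrite deriveZ.
  rewrite (eq_on_derive b oD E Dz).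
  by have [_ _ ? _] := Ck2_derivable b b c1 Dz; rewrite deriveZ.
move=> z Dz; rewrite /laplacian /=.
have := H false z Dz; rewrite /axis => ->; have := H true z Dz; rewrite /axis => ->.
by rewrite -scalerDr; have := l1 z Dz; rewrite /laplacian /= => ->; rewrite scaler0.
Qed.

Lemma harmonic_on_sub D D' g : D' `<=` D -> harmonic_on D g -> harmonic_on D' g.
Proof. by move=> DD [c l]; split; [exact: Ck_on_sub c|move=> z /DD; exact: l]. Qed.

Lemma harmonic_on_shift D g a : harmonic_on D g ->
  harmonic_on [set z | D (z + a)] (fun z => g (z + a)).
Proof.
move=> [c l]; split; first exact: Ck_on_shift.
have E e w : 'D_e ('D_e (fun z => g (z + a))) w = 'D_e ('D_e g) (w + a).
  rewrite (derive_shiftE g a e).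
  by have H := congr1 (@^~ w) (derive_shiftE ('D_e g) a e); exact H.
move=> z Dz; have H := congr2 +%R (E e_x z) (E e_y z).
have Hl := l _ Dz; exact (etrans H Hl).
Qed.

Lemma harmonic_on_ext D g1 g2 : open D -> (forall z, D z -> g1 z = g2 z) ->
  harmonic_on D g1 -> harmonic_on D g2.
Proof.
move=> oD E [c l]; split; first exact: Ck_on_ext c.
move=> z Dz; rewrite -(l z Dz) /laplacian /=.
have H b w : D w -> 'D_(axis b) ('D_(axis b) g1) w = 'D_(axis b) ('D_(axis b) g2) w.
  by apply: eq_on_derive => // ? ?; exact: eq_on_derive oD E _ _.
have := H false z Dz; rewrite /axis => ->.
by have := H true z Dz; rewrite /axis => ->.
Qed.

Lemma harmonic_on_local D g :
  (forall z, D z -> exists2 D', D' z & harmonic_on D' g) -> harmonic_on D g.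
Proof.
move=> H; split; first by apply: Ck_on_local => z /H[D' Dz [c _]]; exists D'.
by move=> z /H[D' Dz [_ l]]; exact: l.
Qed.

Lemma harmonic_derivable D g b z : harmonic_on D g -> D z -> derivable g z (axis b).
Proof. by move=> [gC _] Dz; have [d1 _ _ _] := Ck2_derivable b b gC Dz; exact d1. Qed.

Lemma harmonic_on_continuous D g : harmonic_on D g -> forall z, D z -> {for z, continuous g}.
Proof. by case=> /Ck_on_continuous. Qed.

End CkToolkit.

(** * Locally uniform convergence *)

Section HarmonicLimits.
Context {R : realType}.
Implicit Types (D : set (R * R)) (z : R * R).

Lemma norm_axis b : `|axis b : R * R| = 1.
Proof.
by case: b; rewrite prod_normE /= normr0 normr1; [exact: max_r|exact: max_l].
Qed.

Lemma norm_axes b (s t d : R) : `|s| <= d -> `|t| <= d ->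
  `|t *: (axis (~~ b) : R * R) + s *: axis b| <= d.
Proof.
move=> sd td; rewrite prod_normE /= /GRing.scale /=.
by case: b; rewrite /= !(mulr0, mulr1, addr0, add0r) ge_max sd td.
Qed.

Lemma harmonic_gradient D (u : R * R -> R) z b (d M : R) : harmonic_on D u -> 0 < d -> 0 < M ->
  (forall w, `|w - z| <= d -> D w /\ `|u w| <= M) ->
  `|'D_(axis b) u z| <= 3 * M / d.
Proof.
move=> [uC ul] d0 M0 uD.
apply: (@gradient_estimate R _ u z (axis b) (axis (~~ b)) d M d0 M0) => s t sd td w.
have [Dw uM] : D w /\ `|u w| <= M.
  apply: uD; have -> : w - z = t *: axis (~~ b) + s *: axis b by
    rewrite /w [LHS]addrC -(addrA z) addKr.
  exact: norm_axes.
have [d1 c1 dd1 cc1] := Ck2_derivable b b uC Dw.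
have [d2 c2 dd2 cc2] := Ck2_derivable (~~ b) (~~ b) uC Dw.
split; split => //; first exact: Ck_on_continuous uC _ Dw.
by have H := ul w Dw; rewrite (laplacianE b) in H.
Qed.

Lemma mean_value_line (u : R * R -> R) z e (l eta h : R) :
  (forall t : R, `|t| <= `|h| -> derivable u (z + t *: e) e /\
     `|'D_e u (z + t *: e) - l| <= eta) ->
  `|u (z + h *: e) - u z - h * l| <= eta * `|h|.
Proof.
move=> H; pose g (t : R) := u (z + t *: e).
have dg (t : R) : `|t| <= `|h| -> is_derive t 1 g ('D_e u (z + t *: e)).
  by move=> /H[du _]; have K := is_derive_line du; exact K.
have cg (a b : R) : a <= b -> (forall x, x \in `[a, b]%R -> `|x| <= `|h|) ->
  {within `[a, b], continuous g}.
  move=> ab K; apply: continuous_in_subspaceT => x; rewrite inE /= => /K /dg xd.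
  by have L := is_derive1_continuous xd; exact L.
have fin (c : R) : `|c| <= `|h| -> g h - g 0 = 'D_e u (z + c *: e) * h ->
    `|u (z + h *: e) - u z - h * l| <= eta * `|h|.
  move=> /H[_ Hc]; rewrite /g scale0r addr0 => ->.
  by rewrite mulrC -mulrBr normrM mulrC ler_wpM2r.
have [h0|h0] := leP 0 h.
- have K x : x \in `[0, h]%R -> `|x| <= `|h|.
    by rewrite in_itv /= => /andP[x0 xh]; rewrite !ger0_norm.
  have [x xi|c ci gE] := @MVT_segment R g (fun t => 'D_e u (z + t *: e)) 0 h h0 _ (cg _ _ h0 K).
    by apply: dg; apply: K; exact: subset_itv_oo_cc xi.
  by apply: (fin c); [exact: K|rewrite gE subr0].
- have K x : x \in `[h, 0]%R -> `|x| <= `|h|.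
    by rewrite in_itv /= => /andP[x0 xh]; rewrite !ler0_norm ?lerN2 // ltW.
  have [x xi|c ci gE] := @MVT_segment R g (fun t =>
    'D_e u (z + t *: e)) h 0 (ltW h0) _ (cg _ _ (ltW h0) K).
    by apply: dg; apply: K; exact: subset_itv_oo_cc xi.
  by apply: (fin c); [exact: K|rewrite -opprB gE sub0r mulrN opprK].
Qed.

(** The radius does not depend on eta: convergence is uniform on a fixed ball,
    on which interior estimates can then be applied. *)
Definition lunif_cvg D (u_ : nat -> R * R -> R) u :=
  forall z, D z -> exists2 r : R, 0 < r & forall eta : R, 0 < eta ->
    exists N, forall j w, (N <= j)%N -> `|w - z| < r -> `|u_ j w - u w| <= eta.

Definition lunif_cauchy D (u_ : nat -> R * R -> R) :=
  forall z, D z -> exists2 r : R, 0 < r & forall eta : R, 0 < eta ->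
    exists N, forall i j w, (N <= i)%N -> (N <= j)%N -> `|w - z| < r ->
    `|u_ i w - u_ j w| <= eta.

Lemma lunif_cvg_cauchy D u_ u : lunif_cvg D u_ u -> lunif_cauchy D u_.
Proof.
move=> H z /H[r r0 rP]; exists r => // eta eta0.
have [|N NP] := rP (eta / 2); first by rewrite divr_gt0.
exists N => i j w Ni Nj wr.
by rewrite (splitr eta) (le_trans (ler_distD (u w) _ _)) // lerD ?NP // distrC NP.
Qed.

Lemma lunif_cvg_pointwise D u_ u : lunif_cvg D u_ u -> forall z, D z ->
  (fun j => u_ j z) @ \oo --> u z.
Proof.
move=> H z /H[r r0 rP]; apply/cvgrPdist_le => eta eta0.
have [N NP] := rP _ eta0; exists N => // j /= Nj; rewrite distrC; apply: NP => //.
by rewrite subrr normr0.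
Qed.

Lemma lunif_cauchy_cvg D u_ : lunif_cauchy D u_ ->
  lunif_cvg D u_ (fun z => lim ((fun j => u_ j z) @ \oo)).
Proof.
move=> H z Dz; have [r r0 rP] := H z Dz; exists r => // eta eta0.
have [N NP] := rP _ eta0; exists N => j w Nj wr.
have cv : cvg ((fun j => u_ j w) @ \oo).
  apply/cauchy_cvgP/cauchy_ballP => e e0; have [|K KP] := rP (e / 2); first by rewrite divr_gt0.
  pose A := (fun i => u_ i w) @` [set i | (K <= i)%N].
  exists (A, A); first by split; exists K => // i Ki; exists i.
  move=> [_ _] /= [[i Ki <-] [k Kk <-]].
  rewrite /ball /= (le_lt_trans (KP _ _ _ Ki Kk wr)) //.
  by rewrite ltr_pdivrMr // ltr_pMr // ltr1n.
apply/ler_addgt0Pr => e e0.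
have /cvgrPdist_le /(_ e e0)[K _ KP] := cv.
have := KP (maxn N K) (leq_maxr _ _); rewrite /= distrC => H1.
rewrite (le_trans (ler_distD (u_ (maxn N K) w) _ _)) // lerD //.
by apply: NP => //; exact: leq_maxl.
Qed.

Lemma lunif_cvg_continuous D u_ u : open D -> lunif_cvg D u_ u ->
  (forall j z, D z -> {for z, continuous (u_ j)}) ->
  forall z, D z -> {for z, continuous u}.
Proof.
move=> oD H uc z Dz; have [r r0 rP] := H z Dz.
apply/cvgrPdist_le => eta eta0; have [|N NP] := rP (eta / 3); first by rewrite divr_gt0.
have /cvgrPdist_le /(_ (eta / 3)) := uc N z Dz; rewrite divr_gt0 // => /(_ isT) K.
have B : \forall w \near z, `|w - z| < r.
  by apply/nbhs_dist; exists r.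
near=> w.
have h1 : `|u_ N z - u_ N w| <= eta / 3 by near: w.
have wr : `|w - z| < r by near: w.
have h2 := NP N w (leqnn _) wr.
have h3 : `|u_ N z - u z| <= eta / 3 by apply: NP => //; rewrite subrr normr0.
rewrite distrC in h3.
rewrite (le_trans (ler_distD (u_ N z) _ _)) //.
have := ler_distD (u_ N w) (u_ N z) (u w).
lra.
Unshelve. all: by end_near. Qed.

(** As h is continuous, the derivatives of u_ j for large j are close to h z near
    z. By the mean value theorem the difference quotients of u_ j are as close,
    uniformly in j, hence so are those of the limit. *)
Lemma lunif_cvg_derive D u_ u h b : open D -> lunif_cvg D u_ u ->
  (forall j z, D z -> derivable (u_ j) z (axis b)) ->
  (forall j z, D z -> {for z, continuous ('D_(axis b) (u_ j))}) ->
  lunif_cvg D (fun j => 'D_(axis b) (u_ j)) h ->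
  forall z, D z -> is_derive z (axis b) u (h z).
Proof.
move=> oD Hu ud udc Hh z Dz.
have hc := lunif_cvg_continuous oD Hh udc Dz.
have [r r0 rP] := Hh z Dz.
have [q q0 qD] : exists2 q : R, 0 < q & forall w, `|w - z| < q -> D w.
  by apply/nbhs_dist; apply: open_nbhs_nbhs.
apply: is_derive_approx => eta eta0.
have e2 : 0 < eta / 2 by rewrite divr_gt0.
have [N NP] := rP _ e2.
have /cvgrPdist_le /(_ _ e2) /nbhs_dist [p p0 pP] := hc.
exists (Num.min r (Num.min q p)); first by rewrite !lt_min r0 q0.
move=> t; rewrite !lt_min => /and3P[tr tq tp].
have Dt s : `|s| <= `|t| -> D (z + s *: axis b).
  move=> st; apply: qD; rewrite addrC addKr.
  by rewrite normrZ norm_axis mulr1 (le_lt_trans st).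
have B j : (N <= j)%N -> `|u_ j (z + t *: axis b) - u_ j z - t * h z| <= eta * `|t|.
  move=> Nj; apply: mean_value_line => s st; split; first exact/ud/Dt.
  have sz : `|(z + s *: axis b) - z| = `|s|.
    by rewrite addrC addKr normrZ norm_axis mulr1.
  have h1 := NP j (z + s *: axis b) Nj; rewrite sz (le_lt_trans st tr) in h1.
  have {}h1 := h1 isT.
  have h2 : `|h z - h (z + s *: axis b)| <= eta / 2.
    by apply: pP; rewrite sz (le_lt_trans st).
  rewrite distrC in h2.
  rewrite (le_trans (ler_distD (h (z + s *: axis b)) _ _)) // (splitr eta) lerD //.
apply/ler_addgt0Pr => e e0.
have e02 : 0 < e / 2 by rewrite divr_gt0.
have Dz' : D (z + t *: axis b) by apply: Dt.
have /cvgrPdist_le /(_ _ e02)[K1 _ K1P] := lunif_cvg_pointwise Hu Dz.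
have /cvgrPdist_le /(_ _ e02)[K2 _ K2P] := lunif_cvg_pointwise Hu Dz'.
pose j := maxn N (maxn K1 K2).
have := B j (leq_maxl _ _).
have := K1P j; rewrite /= leq_max leq_max leqnn orbT => /(_ isT) h1.
have := K2P j; rewrite /= leq_max leq_max leqnn !orbT => /(_ isT) h2 h3.
move: h1 h2 h3; rewrite /GRing.scale /= !ler_norml.
move=> /andP[a1 a2] /andP[b1 b2] /andP[c1 c2]; apply/andP; split; lra.
Qed.

End HarmonicLimits.

(** * Limits and derivatives of harmonic functions *)

Section HarmonicLimits2.
Context {R : realType}.
Implicit Types (D : set (R * R)) (z : R * R).

Lemma open_dist D z : open D -> D z -> exists2 q : R, 0 < q & forall w, `|w - z| < q -> D w.
Proof. by move=> oD Dz; apply/nbhs_dist; apply: open_nbhs_nbhs. Qed.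

Lemma derive_subE D (u v : R * R -> R) b z : D z ->
  (forall w, D w -> derivable u w (axis b)) -> (forall w, D w -> derivable v w (axis b)) ->
  'D_(axis b) (u \- v) z = 'D_(axis b) u z - 'D_(axis b) v z.
Proof. by move=> Dz du dv; rewrite -deriveB; [|exact: du|exact: dv]. Qed.

Lemma norm_le_dist1 (L x : R) : `|L - x| <= 1 -> `|x| <= `|L| + 1.
Proof.
move=> H; have := ler_normB L (L - x); rewrite opprB addrC subrK => H'.
by rewrite (le_trans H') // lerD.
Qed.

Lemma open_shift D a : open D -> open [set z : R * R | D (z + a)].
Proof.
move=> oD; apply: (@open_comp _ _ (fun z : R * R => z + a) D) => // z _.
by apply: cvgD; [exact: cvg_id|exact: cvg_cst].
Qed.

Definition diff_quotient (u : R * R -> R) b (t : R) : R * R -> R :=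
  t^-1 \*: ((fun w => u (w + t *: axis b)) \- u).

Lemma harmonic_diff_quotient D u b t : open D -> harmonic_on D u ->
  harmonic_on (D `&` [set w | D (w + t *: axis b)]) (diff_quotient u b t).
Proof.
move=> oD uh.
have oE : open (D `&` [set w | D (w + t *: axis b)]) by apply: openI => //; exact: open_shift.
have h1 := harmonic_on_sub (@subIsetr _ D _) (harmonic_on_shift (t *: axis b) uh).
have h2 := harmonic_on_sub (@subIsetl _ D [set w | D (w + t *: axis b)]) uh.
have H := harmonic_onZ t^-1 oE (harmonic_onB oE h1 h2); exact H.
Qed.

Lemma diff_quotient_bound u w b (t l eta : R) : t != 0 ->
  (forall s : R, `|s| <= `|t| -> derivable u (w + s *: axis b) (axis b) /\
     `|'D_(axis b) u (w + s *: axis b) - l| <= eta) ->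
  `|diff_quotient u b t w - l| <= eta.
Proof.
move=> t0 /mean_value_line H; rewrite /diff_quotient /=.
have -> : t^-1 *: (u (w + t *: axis b) - u w) - l = t^-1 * (u (w + t *: axis b) - u w - t * l).
  by rewrite [in RHS]mulrBr mulKf.
by rewrite normrM normfV ler_pdivrMl ?normr_gt0 // [leRHS]mulrC.
Qed.

Lemma derive_diff_quotient D u b b' t z : open D -> harmonic_on D u -> D z ->
  D (z + t *: axis b) ->
  'D_(axis b') (diff_quotient u b t) z = t^-1 * ('D_(axis b') u
    (z + t *: axis b) - 'D_(axis b') u z).
Proof.
move=> oD [uC _] Dz Dz'.
have [d1 _ _ _] := Ck2_derivable b' b' uC Dz.
have [d2 _ _ _] := Ck2_derivable b' b' uC Dz'.
have d3 := derivable_shift d2.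
have d4 : derivable ((fun w => u (w + t *: axis b)) - u) z (axis b') by apply: derivableB.
rewrite /diff_quotient (deriveZ _ d4) (deriveB d3 d1).
by have H := congr1 (@^~ z) (derive_shiftE u (t *: axis b) (axis b')); rewrite /= in H;
  rewrite H.
Qed.

(** A harmonic function of class C^2 has a priori no third derivatives, so the
    gradient estimate does not apply to its derivatives. It applies to the
    difference quotients of u, which are harmonic and, by the gradient estimate
    for u, bounded; their gradients tend to the second derivatives. *)
Lemma harmonic_hessian D (u : R * R -> R) z b b' (d M : R) : open D -> harmonic_on D u ->
  0 < d -> 0 < M ->
  (forall w, `|w - z| <= 3 * d -> D w /\ `|u w| <= M) ->
  `|'D_(axis b) ('D_(axis b') u) z| <= 9 * M / d ^+ 2.
Proof.
move=> oD uh d0 M0 uD.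
have G b0 w : `|w - z| <= 2 * d -> `|'D_(axis b0) u w| <= 3 * M / d.
  move=> wz; apply: (@harmonic_gradient _ D) => // w' w'w; apply: uD.
  by rewrite (le_trans (ler_distD w _ _)) //; lra.
have tr w s c : `|w - z| <= c -> `|(w + s *: axis b) - z| <= c + `|s|.
  move=> wz; rewrite addrAC (le_trans (ler_normD _ _)) // lerD //.
  by rewrite normrZ norm_axis mulr1.
have z0 : `|z - z| <= 0 by rewrite subrr normr0.
have Q (t : R) : t != 0 -> `|t| <= d ->
   `|t^-1 * ('D_(axis b') u (z + t *: axis b) - 'D_(axis b') u z)| <= 9 * M / d ^+ 2.
  move=> t0 td.
  have Dz : D z by case: (uD z); rewrite ?subrr ?normr0 //; lra.
  have Dz' : D (z + t *: axis b).
    by case: (uD (z + t *: axis b)) => //; rewrite (le_trans (tr _ _ _ z0)) //; lra.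
  rewrite -(derive_diff_quotient b' oD uh Dz Dz').
  have -> : 9 * M / d ^+ 2 = 3 * (3 * M / d) / d by field; rewrite gt_eqF.
  have HG := @harmonic_gradient R _ (diff_quotient u b t) z b' d (3 * M / d)
    (harmonic_diff_quotient b t oD uh) d0; apply HG.
    by rewrite divr_gt0 // mulr_gt0.
  move=> w wz; split.
    split; first by case: (uD w) => //; lra.
    by case: (uD (w + t *: axis b)) => //; have := tr w t d wz; lra.
  rewrite -[diff_quotient u b t w]subr0; apply: diff_quotient_bound => // s st.
  have ws := tr w s d wz.
  rewrite subr0; split; last by apply: G; lra.
  have [uC _] := uh.
  have Ds : D (w + s *: axis b) by case: (uD (w + s *: axis b)) => //; lra.
  by have [du _ _ _] := Ck2_derivable b b uC Ds; exact du.
have [uC _] := uh.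
have Dz : D z by case: (uD z); rewrite ?subrr ?normr0 //; lra.
have [_ _ dd _] := Ck2_derivable b' b uC Dz.
apply/ler_addgt0Pr => e e0.
have [r r0 rP] := derive_approx dd e0.
pose t := Num.min r d / 2.
have m0 : 0 < Num.min r d by rewrite lt_min r0.
have m1 : Num.min r d <= r by rewrite ge_min lexx.
have m2 : Num.min r d <= d by rewrite ge_min lexx orbT.
have t0 : 0 < t by rewrite divr_gt0.
have tE : `|t| = t by rewrite gtr0_norm.
have := rP t; rewrite tE => /(_ ltac:(rewrite /t; lra)).
have := Q t; rewrite tE => /(_ (lt0r_neq0 t0) ltac:(rewrite /t; lra)).
set X := 'D_(axis b') u _ - _; set L := 'D_(axis b) _ _.
rewrite normrM normfV tE ler_pdivrMl // => H1 H2.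
have : `|t * L| <= t * (9 * M / d ^+ 2 + e).
  have -> : t * L = X - (X - t *: L) by rewrite opprB addrC subrK.
  rewrite (le_trans (ler_normB _ _)) //.
  by rewrite mulrDr lerD // mulrC.
by rewrite normrM tE ler_pM2l.
Qed.

Lemma harmonic_cauchy_derive D (u_ : nat -> R * R -> R) b : open D ->
  (forall j, harmonic_on D (u_ j)) -> lunif_cauchy D u_ ->
  lunif_cauchy D (fun j => 'D_(axis b) (u_ j)).
Proof.
move=> oD uh H z Dz; have [r r0 rP] := H z Dz; have [q q0 qD] := open_dist oD Dz.
have m0 : 0 < Num.min r q by rewrite lt_min r0.
have m1 : Num.min r q <= r by rewrite ge_min lexx.
have m2 : Num.min r q <= q by rewrite ge_min lexx orbT.
set m := Num.min r q in m0 m1 m2.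
pose d := m / 3; have d0 : 0 < d by rewrite divr_gt0.
exists d => // eta eta0.
have M0 : 0 < eta * d / 3 by rewrite divr_gt0 // mulr_gt0.
have [N NP] := rP _ M0; exists N => i j w Ni Nj wz.
have Dw : D w by apply: qD; rewrite /d in wz; lra.
have [ci _] := uh i; have [cj _] := uh j.
rewrite -(@derive_subE D) => // [|w' Dw'|w' Dw']; last first.
- by have [] := Ck2_derivable b b cj Dw'.
- by have [] := Ck2_derivable b b ci Dw'.
have -> : eta = 3 * (eta * d / 3) / d by field; rewrite gt_eqF.
have HG := @harmonic_gradient R _ _ w b d (eta * d / 3) (harmonic_onB oD (uh i)
  (uh j)) d0 M0; apply HG => w' ww'.
have wz' : `|w' - z| <= 2 * d by rewrite (le_trans (ler_distD w _ _)) //; lra.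
split; first by apply: qD; move: wz'; rewrite /d; lra.
by apply: NP => //; move: wz'; rewrite /d; lra.
Qed.

Lemma harmonic_cauchy_derive2 D (u_ : nat -> R * R -> R) b b' : open D ->
  (forall j, harmonic_on D (u_ j)) -> lunif_cauchy D u_ ->
  lunif_cauchy D (fun j => 'D_(axis b) ('D_(axis b') (u_ j))).
Proof.
move=> oD uh H z Dz; have [r r0 rP] := H z Dz; have [q q0 qD] := open_dist oD Dz.
have m0 : 0 < Num.min r q by rewrite lt_min r0.
have m1 : Num.min r q <= r by rewrite ge_min lexx.
have m2 : Num.min r q <= q by rewrite ge_min lexx orbT.
set m := Num.min r q in m0 m1 m2.
pose d := m / 5; have d0 : 0 < d by rewrite divr_gt0.
exists d => // eta eta0.
have M0 : 0 < eta * d ^+ 2 / 9 by rewrite divr_gt0 // mulr_gt0 // exprn_gt0.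
have [N NP] := rP _ M0; exists N => i j w Ni Nj wz.
have Dw : D w by apply: qD; rewrite /d in wz; lra.
have [ci _] := uh i; have [cj _] := uh j.
rewrite -(@derive_subE D) => // [|w' Dw'|w' Dw']; last first.
- by have [] := Ck2_derivable b' b cj Dw'.
- by have [] := Ck2_derivable b' b ci Dw'.
have E w' : D w' -> ('D_(axis b') (u_ i) \- 'D_(axis b') (u_ j)) w' =
  'D_(axis b') (u_ i \- u_ j) w'.
  move=> Dw'; rewrite (@derive_subE D) // => v Dv.
    by have [] := Ck2_derivable b' b ci Dv.
  by have [] := Ck2_derivable b' b cj Dv.
rewrite (eq_on_derive b oD E Dw).
have -> : eta = 9 * (eta * d ^+ 2 / 9) / d ^+ 2 by field; rewrite gt_eqF.
have HG := @harmonic_hessian D _ w b b' d (eta * d ^+ 2 / 9) oD (harmonic_onB oD (uh i)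
  (uh j)) d0 M0; apply HG => w' ww'.
have wz' : `|w' - z| <= 4 * d by rewrite (le_trans (ler_distD w _ _)) //; lra.
split; first by apply: qD; move: wz'; rewrite /d; lra.
by apply: NP => //; move: wz'; rewrite /d; lra.
Qed.

Lemma lunif_cvg_ext D u_ v_ u v : open D ->
  (forall j z, D z -> u_ j z = v_ j z) -> (forall z, D z -> u z = v z) ->
  lunif_cvg D u_ u -> lunif_cvg D v_ v.
Proof.
move=> oD E1 E2 H z Dz; have [r r0 rP] := H z Dz; have [q q0 qD] := open_dist oD Dz.
exists (Num.min r q); first by rewrite lt_min r0.
move=> eta eta0; have [N NP] := rP _ eta0; exists N => j w Nj.
rewrite lt_min => /andP[wr wq]; have Dw := qD _ wq.
by rewrite -E1 // -E2 // NP.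
Qed.

(** By the interior estimates the first and second derivatives of u_ are locally
    uniformly Cauchy as well. So the limit is of class C^2, and its Laplacian is a
    limit of zeros. *)
Lemma harmonic_limit D (u_ : nat -> R * R -> R) u : open D ->
  (forall j, harmonic_on D (u_ j)) -> lunif_cvg D u_ u ->
  harmonic_on D u /\ forall b, lunif_cvg D (fun j => 'D_(axis b) (u_ j)) ('D_(axis b) u).
Proof.
move=> oD uh Hu; have Hc := lunif_cvg_cauchy Hu.
have C b b' j z (Dz : D z) := Ck2_derivable b b' (uh j).1 Dz.
have L1 b : (forall z, D z -> derivable u z (axis b)) /\
    lunif_cvg D (fun j => 'D_(axis b) (u_ j)) ('D_(axis b) u).
  have H1 := lunif_cauchy_cvg (harmonic_cauchy_derive b oD uh Hc).
  have dv : forall z, D z -> is_derive z (axis b) u (lim ((fun j =>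
    'D_(axis b) (u_ j) z) @ \oo)).
    by apply: (lunif_cvg_derive oD Hu) => // j z Dz; have [] := C b b j z Dz.
  split; first by move=> z /dv[].
  by apply: lunif_cvg_ext H1 => // z /dv[].
have L2 b b' : (forall z, D z -> derivable ('D_(axis b') u) z (axis b)) /\
    lunif_cvg D (fun j => 'D_(axis b) ('D_(axis b') (u_ j))) ('D_(axis b) ('D_(axis b') u)).
  have H1 := lunif_cauchy_cvg (harmonic_cauchy_derive2 b b' oD uh Hc).
  have dv : forall z, D z -> is_derive z (axis b) ('D_(axis b') u)
      (lim ((fun j => 'D_(axis b) ('D_(axis b') (u_ j)) z) @ \oo)).
    apply: (lunif_cvg_derive oD (L1 b').2) => // j z Dz; have [] := C b' b j z Dz => //.
  split; first by move=> z /dv[].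
  by apply: lunif_cvg_ext H1 => // z /dv[].
split; last by move=> b; exact: (L1 b).2.
split.
  apply/Ck_onS; split.
    have H := lunif_cvg_continuous oD Hu (fun j z Dz => harmonic_on_continuous (uh j) Dz);
      exact H.
  move=> b; split; first exact: (L1 b).1.
  apply/Ck_onS; split.
    by apply: (lunif_cvg_continuous oD (L1 b).2) => j z Dz; have [] := C b b j z Dz.
  move=> b'; split; first exact: (L2 b' b).1.
  split => //; apply: (lunif_cvg_continuous oD (L2 b' b).2) => j z Dz.
  by have [] := C b b' j z Dz.
move=> z Dz; rewrite (laplacianE true).
have c1 := lunif_cvg_pointwise (L2 true true).2 Dz.
have c2 := lunif_cvg_pointwise (L2 false false).2 Dz.
have c3 : (fun j => 0 : R) @ \oo --> 'D_(axis true) ('D_(axis true) u) z +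
    'D_(axis false) ('D_(axis false) u) z.
  have -> : (fun j : nat => 0 : R) = (fun j => 'D_(axis true) ('D_(axis true) (u_ j)) z +
    'D_(axis false) ('D_(axis false) (u_ j)) z).
    apply/funext => j; have := (uh j).2 z Dz; rewrite (laplacianE true) => H; by rewrite -H.
  exact: cvgD c1 c2.
by rewrite -(cvg_lim (@Rhausdorff R) c3) lim_cst //; exact: Rhausdorff.
Qed.

(** Smoothness without an integral representation: a derivative of u is the
    locally uniform limit of difference quotients, which are harmonic. The rate
    of convergence comes from a local bound B of the second derivative. *)
Lemma harmonic_derive D (u : R * R -> R) b : open D -> harmonic_on D u ->
  harmonic_on D ('D_(axis b) u).
Proof.
move=> oD uh; apply: harmonic_on_local => z Dz.
have [q q0 qD] := open_dist oD Dz.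
have Ch z' (Dz' : D z') := Ck2_derivable b b uh.1 Dz'.
have [d1 c1 dd1 cc1] := Ch z Dz.
pose B := `|'D_(axis b) ('D_(axis b) u) z| + 1.
have [p p0 pP] : exists2 p : R, 0 < p &
    forall w, `|w - z| < p -> `|'D_(axis b) ('D_(axis b) u) w| <= B.
  apply/nbhs_dist; move/cvgrPdist_le : cc1 => /(_ 1 ltr01); apply: filterS => w H.
  by have H' := norm_le_dist1 H; exact H'.
pose m := Num.min q p.
have m0 : 0 < m by rewrite lt_min q0.
have m1 : m <= q by rewrite ge_min lexx.
have m2 : m <= p by rewrite ge_min lexx orbT.
pose r := m / 3; have r0 : 0 < r by rewrite divr_gt0.
pose D' := [set w : R * R | `|w - z| < r].
have oD' : open D'.
  have -> : D' = ball z r by apply/seteqP; split=> w; rewrite /D' -ball_normE /= distrC.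
  exact: ball_open.
exists D'; first by rewrite /D' /= subrr normr0.
pose t_ (j : nat) := r / j.+1%:R.
have t0 j : 0 < t_ j by rewrite divr_gt0.
have tr j : t_ j <= r by rewrite ler_pdivrMr // ler_peMr ?ler1n // ltW.
have sh w s : D' w -> `|s| <= r -> `|(w + s *: axis b) - z| < 2 * r.
  rewrite /D' /= => wz sr; rewrite addrAC (le_lt_trans (ler_normD _ _)) //.
  by rewrite normrZ norm_axis mulr1 mulr_natl mulr2n ltr_leD.
have q2 w : `|w - z| < 3 * r -> D w by move=> H; apply: qD; move: H; rewrite /r; lra.
have p2 w : `|w - z| < 3 * r -> `|'D_(axis b) ('D_(axis b) u) w| <= B.
  by move=> H; apply: pP; move: H; rewrite /r; lra.
have uh' j : harmonic_on D' (diff_quotient u b (t_ j)).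
  apply: harmonic_on_sub (harmonic_diff_quotient b (t_ j) oD uh) => w D'w; split.
    by apply: q2; move: D'w; rewrite /D' /=; lra.
  by apply: q2; have := sh w (t_ j) D'w; rewrite gtr0_norm // => /(_ (tr j)); lra.
have B0 : 0 < B by rewrite /B ltr_wpDl.
suff H : lunif_cvg D' (fun j => diff_quotient u b (t_ j)) ('D_(axis b) u).
  by have [] := harmonic_limit oD' uh' H.
move=> z' D'z'.
have [r' r'0 r'P] := open_dist oD' D'z'.
exists r' => // eta eta0.
pose N := Num.truncn (B * r / eta); exists N => j w Nj /r'P D'w.
have bt : B * t_ j <= eta.
  rewrite /t_ mulrA ler_pdivrMr // [leRHS]mulrC -ler_pdivrMr //.
  have := truncnS_gt (B * r / eta); rewrite -/N => H.
  by apply: ltW; apply: lt_le_trans H _; rewrite ler_nat ltnS.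
apply: le_trans bt; apply: diff_quotient_bound => [|s st]; first by rewrite gt_eqF.
rewrite (gtr0_norm (t0 j)) in st.
have Ds s' : `|s'| <= r -> D (w + s' *: axis b).
  by move=> s'r; apply: q2; have := sh w s' D'w s'r; lra.
have [ds _ dds _] := Ch _ (Ds _ (le_trans st (tr j))).
split => //.
have := @mean_value_line _ ('D_(axis b) u) w (axis b) 0 B s.
rewrite mulr0 subr0 => H; apply: le_trans (H _) _.
  move=> s' ss'; have s'r : `|s'| <= r by rewrite (le_trans ss') // (le_trans st).
  have [_ _ ? _] := Ch _ (Ds _ s'r); split => //.
  by rewrite subr0; apply: p2; have := sh w s' D'w s'r; lra.
by rewrite ler_pM2l.
Qed.

End HarmonicLimits2.

(** * Vector-valued harmonic maps and conformal immersions *)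

Lemma differentiable_approx_lin (R : realType) (V W : normedModType R) (g : V -> W) (z : V)
  (L : {linear V -> W}) : continuous L ->
  (forall eta : R, 0 < eta -> \forall w \near z,
    `|g w - g z - L (w - z)| <= eta * `|w - z|) ->
  differentiable g z /\ 'd g z = L :> (V -> W).
Proof.
move=> Lc H.
have E : g \o shift z = cst (g z) + L +o_ 0 id.
  apply/eqaddoP => _/posnumP[e].
  have := H e%:num [gt0 of e%:num]; rewrite (near_shift 0) /=.
  apply: filterS => v; rewrite /= subr0 addrK => K.
  by rewrite !fctE /= opprD addrA.
have D := diff_unique Lc E; split => //.
by apply/diff_locallyP; rewrite D; split.
Qed.

Section Differentiability.
Context {R : realType} {W : normedModType R}.

Lemma differentiable_approx (g : R * R -> W) (z : R * R) (a b : W) :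
  (forall eta : R, 0 < eta -> \forall w \near z,
    `|g w - g z - ((w - z).1 *: a + (w - z).2 *: b)| <= eta * `|w - z|) ->
  differentiable g z /\ forall v, 'd g z v = v.1 *: a + v.2 *: b.
Proof.
move=> H.
pose l (v : R * R) : W := v.1 *: a + v.2 *: b.
have lin : linear l.
  by move=> k u v; rewrite /l /= !scalerDl -!scalerA addrACA -scalerDr.
pose lM := GRing.isLinear.Build _ _ _ _ _ lin.
pose L : {linear (R * R)%type -> W} := HB.pack l lM.
have Lc : continuous L.
  move=> v; apply: cvgD; apply: cvgZl; [exact: cvg_fst|exact: cvg_snd].
have [d1 d2] := differentiable_approx_lin Lc H.
by split => // v; rewrite d2.
Qed.

End Differentiability.

Section Vector.
Context {R : realType} {n : nat}.
Implicit Types (D : set (R * R)) (z : R * R).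

Definition coordf (i : 'I_n) (g : R * R -> 'rV[R]_n) : R * R -> R := fun z => g z 0 i.

Lemma coord_le_norm (v : 'rV[R]_n) i : `|v 0 i| <= `|v|.
Proof.
by rewrite [leRHS]/Num.Def.normr/= mx_normrE; exact: (le_bigmax _ _ (0, i)).
Qed.

Lemma norm_le_coord (v : 'rV[R]_n) (c : R) : 0 <= c -> (forall i, `|v 0 i| <= c) -> `|v| <= c.
Proof.
move=> c0 H; rewrite [leLHS]/Num.Def.normr/= mx_normrE (bigmax_le _ c0) //= => -[i j] _.
by rewrite ord1; exact: H.
Qed.

Lemma derivable_coordf (g : R * R -> 'rV[R]_n) z e : derivable g z e <->
  forall i, derivable (coordf i g) z e.
Proof.
split=> [/derivable_mxP H i|H]; first exact: H.
by apply/derivable_mxP => i j; rewrite ord1; exact: H.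
Qed.

Lemma derive_coordf (g : R * R -> 'rV[R]_n) z e i : derivable g z e ->
  'D_e g z 0 i = 'D_e (coordf i g) z.
Proof. by move=> dg; rewrite derive_mx // mxE. Qed.

Lemma continuous_coordf (g : R * R -> 'rV[R]_n) z : {for z, continuous g} <->
  forall i, {for z, continuous (coordf i g)}.
Proof.
split=> [gc i|H].
  apply/cvgrPdist_le => e e0; move/cvgrPdist_le : gc => /(_ e e0); apply: filterS => w.
  apply: le_trans; have := coord_le_norm (g z - g w) i.
  by rewrite !mxE.
apply/cvgrPdist_le => e e0.
have K0 i : \forall w \near z, `|coordf i g z - coordf i g w| <= e.
  by move/cvgrPdist_le : (H i) => /(_ e e0).
have K := filter_forall (nbhs_filter z) K0.
apply: filterS K => w K; apply: norm_le_coord; first exact: ltW.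
by move=> i; have := K i; rewrite /coordf !mxE.
Qed.

Lemma Ck_on_coordf k D (g : R * R -> 'rV[R]_n) : open D ->
  Ck_on k D g <-> forall i, Ck_on k D (coordf i g).
Proof.
move=> oD; elim: k g => [|k IH] g.
  split=> [[gc _] i|H]; split => // z Dz.
    by have /continuous_coordf := gc z Dz; apply.
  by apply/continuous_coordf => i; case: (H i) => + _; apply.
split=> [/Ck_onS[gc gb] i|H].
  apply/Ck_onS; split; first by move=> z Dz; have /continuous_coordf := gc z Dz; apply.
  move=> b; have [gd gC] := gb b; split.
    by move=> z Dz; have /derivable_coordf := gd z Dz; apply.
  have /IH/(_ i) := gC; apply: Ck_on_ext => // z Dz.
  by rewrite -derive_coordf //; exact: gd.
have gd b z : D z -> derivable g z (axis b).
  by move=> Dz; apply/derivable_coordf => i; have /Ck_onS[_ /(_ b)[+ _]] := H i; apply.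
apply/Ck_onS; split.
  by move=> z Dz; apply/continuous_coordf => i; have /Ck_onS[+ _] := H i; apply.
move=> b; split; first exact: gd.
apply/IH => i; have /Ck_onS[_ /(_ b)[_]] := H i; apply: Ck_on_ext => // z Dz.
by rewrite -derive_coordf //; exact: gd.
Qed.

Lemma harmonic_on_coordf D (g : R * R -> 'rV[R]_n) : open D ->
  harmonic_on D g <-> forall i, harmonic_on D (coordf i g).
Proof.
move=> oD.
have L : Ck_on 2 D g -> forall i z, D z -> laplacian g z 0 i = laplacian (coordf i g) z.
  move=> gC i z Dz.
  have E b : 'D_(axis b) ('D_(axis b) g) z 0 i = 'D_(axis b) ('D_(axis b) (coordf i g)) z.
    have [_ _ d2 _] := Ck2_derivable b b gC Dz; rewrite (derive_coordf _ d2).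
    apply: (eq_on_derive b oD _ Dz) => w Dw.
    by have [d1 _ _ _] := Ck2_derivable b b gC Dw; have H := derive_coordf i d1; exact H.
  rewrite !(laplacianE true) mxE.
  by have H := congr2 +%R (E true) (E false); exact H.
split=> [[gC gl] i|H].
  split; first by move/(Ck_on_coordf _ _ oD) : gC; apply.
  by move=> z Dz; rewrite -L // gl // mxE.
have gC : Ck_on 2 D g by apply/(Ck_on_coordf _ _ oD) => i; case: (H i).
split => // z Dz; apply/rowP => i; rewrite L // mxE.
by case: (H i) => _; apply.
Qed.

Lemma harmonic_derive_vec D (g : R * R -> 'rV[R]_n) b : open D -> harmonic_on D g ->
  harmonic_on D ('D_(axis b) g).
Proof.
move=> oD gh; apply/(harmonic_on_coordf _ oD) => i.
move/(harmonic_on_coordf _ oD) : (gh) => /(_ i) /(harmonic_derive b oD).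
apply: harmonic_on_ext => // z Dz.
by rewrite -derive_coordf //; exact: harmonic_derivable gh Dz.
Qed.

Definition lunif_cvg_vec D (g_ : nat -> R * R -> 'rV[R]_n) (g : R * R -> 'rV[R]_n) :=
  forall i, lunif_cvg D (fun j => coordf i (g_ j)) (coordf i g).

Lemma harmonic_limit_vec D (g_ : nat -> R * R -> 'rV[R]_n) (g : R * R ->
  'rV[R]_n) : open D -> (forall j, harmonic_on D (g_ j)) ->
  lunif_cvg_vec D g_ g -> harmonic_on D g /\ forall b, lunif_cvg_vec D (fun j =>
    'D_(axis b) (g_ j)) ('D_(axis b) g).
Proof.
move=> oD gh H.
have K i := harmonic_limit oD (fun j => (harmonic_on_coordf (g_ j) oD).1 (gh j) i) (H i).
have gh' : harmonic_on D g by apply/(harmonic_on_coordf _ oD) => i; case: (K i).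
have E (h : R * R -> 'rV[R]_n) b i z : harmonic_on D h -> D z ->
    'D_(axis b) (coordf i h) z = coordf i ('D_(axis b) h) z.
  by move=> hh Dz; have Q := derive_coordf i (harmonic_derivable (b :=
    b) hh Dz); exact (esym Q).
split => // b i; have [_ /(_ b) L] := K i.
have Q := lunif_cvg_ext oD (fun j z Dz => E (g_ j) b i z (gh j) Dz) (fun z Dz =>
  E g b i z gh' Dz) L.
exact Q.
Qed.

(** Differentiation preserves harmonicity and locally uniform convergence. This
    is how jets pass to the limit. *)
Lemma partial_limit D (g_ : nat -> R * R -> 'rV[R]_n) (g : R * R ->
  'rV[R]_n) i j : open D -> (forall k, harmonic_on D (g_ k)) ->
  lunif_cvg_vec D g_ g -> lunif_cvg_vec D (fun k => partial i j (g_ k)) (partial i j g).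
Proof.
move=> oD gh H; suff [] : (forall k, harmonic_on D (partial i j (g_ k))) /\
  lunif_cvg_vec D (fun k => partial i j (g_ k)) (partial i j g) by [].
have S b h_ h : ((forall k, harmonic_on D (h_ k)) /\ lunif_cvg_vec D h_ h) ->
    ((forall k, harmonic_on D ('D_(axis b) (h_ k))) /\
      lunif_cvg_vec D (fun k => 'D_(axis b) (h_ k)) ('D_(axis b) h)).
  move=> [h1 h2]; split; first by move=> k; exact: harmonic_derive_vec.
  by have [_] := harmonic_limit_vec oD h1 h2; apply.
rewrite /partial; elim: i => [|i IH].
  elim: j => [//|j IH]; exact: (S true _ _ IH).
exact: (S false _ _ IH).
Qed.

Lemma lunif_cvg_eventually_cst D (g_ : nat -> R * R -> 'rV[R]_n) (g : R * R ->
  'rV[R]_n) z (l : 'rV[R]_n) N : D z -> lunif_cvg_vec D g_ g ->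
  (forall k, (N <= k)%N -> g_ k z = l) -> g z = l.
Proof.
move=> Dz H E; apply/rowP => i; have := lunif_cvg_pointwise (H i) Dz.
have c : (fun k => coordf i (g_ k) z) @ \oo --> l 0 i.
  apply: cvg_near_cst; exists N => // k /= Nk; by rewrite /coordf E.
move=> c'; have e1 := cvg_lim (@Rhausdorff R) c.
by have e2 := cvg_lim (@Rhausdorff R) c'; exact (etrans (esym (e2 _)) (e1 _)).
Qed.

Lemma harmonic_approx_scalar D (u : R * R -> R) z (eta : R) : open D -> harmonic_on D u ->
  D z -> 0 < eta -> \forall w \near z,
    `|u w - u z - ((w - z).1 * 'D_(axis false) u z + (w - z).2 * 'D_(axis true) u z)|
      <= eta * `|w - z|.
Proof.
move=> oD uh Dz eta0.
have [q q0 qD] := open_dist oD Dz.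
have [uC _] := uh.
have e2 : 0 < eta / 2 by rewrite divr_gt0.
have C b := let: And4 _ c _ _ := Ck2_derivable b b uC Dz in c.
have [p p0 pP] : exists2 p : R, 0 < p & forall w, `|w - z| < p -> forall b,
    `|'D_(axis b) u w - 'D_(axis b) u z| <= eta / 2.
  have K0 b : \forall w \near z, `|'D_(axis b) u w - 'D_(axis b) u z| <= eta / 2.
    by move/cvgrPdist_le : (C b) => /(_ _ e2); apply: filterS => w; rewrite distrC.
  by have /nbhs_dist K := filter_forall (nbhs_filter z) K0; exact: K.
apply/nbhs_dist; exists (Num.min q p); first by rewrite lt_min q0.
move=> w; rewrite lt_min => /andP[wq wp].
set v := w - z in wq wp *.
have v1 : `|v.1| <= `|v| by rewrite prod_normE le_max lexx.
have v2 : `|v.2| <= `|v| by rewrite prod_normE le_max lexx orbT.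
have wE : w = (z + v.1 *: axis false) + v.2 *: axis true.
  rewrite -addrA; apply/eqP; rewrite -subr_eq0 opprD addrA -/v subr_eq0; apply/eqP.
  by rewrite [LHS]surjective_pairing /axis /e_x /e_y; congr pair;
     rewrite /= /GRing.scale /= !(mulr0, mulr1, addr0, add0r).
have P s t : `|s| <= `|v| -> `|t| <= `|v| -> `|(z + s *: axis false) + t *: axis true - z|
  <= `|v|.
  move=> sv tv; rewrite [X in `|X|]addrC -(addrA z) addKr addrC.
  by have := @norm_axes R false s t `|v| sv tv; rewrite addrC.
have B1 := @mean_value_line _ u (z + v.1 *: axis false) (axis true) ('D_(axis true) u z)
  (eta / 2) v.2.
have B2 := @mean_value_line _ u z (axis false) ('D_(axis false) u z) (eta / 2) v.1.
have {}B1 : `|u w - u (z + v.1 *: axis false) - v.2 * 'D_(axis true) u z| <= eta / 2 * `|v.2|.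
  rewrite [in u w]wE; apply: B1 => t tv.
  have := P v.1 t v1 (le_trans tv v2) => Q; split; last by apply: pP; exact: le_lt_trans Q wp.
  by have [dg _ _ _] := Ck2_derivable true true uC (qD _ (le_lt_trans Q wq)).
have {}B2 : `|u (z + v.1 *: axis false) - u z - v.1 * 'D_(axis false) u z| <= eta / 2 * `|v.1|.
  apply: B2 => t tv.
  have := P t 0 (le_trans tv v1) _; rewrite scale0r addr0 normr0 normr_ge0 => /(_ isT) Q.
  split; last by apply: pP; exact: le_lt_trans Q wp.
  by have [dg _ _ _] := Ck2_derivable false false uC (qD _ (le_lt_trans Q wq)).
set a := u w in B1 *; set b := u (z + _) in B1 B2; set c := u z in B2 *.
have -> : a - c - (v.1 * 'D_(axis false) u z + v.2 * 'D_(axis true) u z) =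
  (a - b - v.2 * 'D_(axis true) u z) + (b - c - v.1 * 'D_(axis false) u z) by ring.
rewrite (le_trans (ler_normD _ _)) //.
apply: le_trans (lerD B1 B2) _.
rewrite [leRHS](_ : _ = eta / 2 * `|v| + eta / 2 * `|v|); last by field.
by rewrite lerD // ler_pM2l.
Qed.

Lemma coord_combination (A B a b : 'rV[R]_n) (s t : R) i :
  (A - B - (s *: a + t *: b)) 0 i = A 0 i - B 0 i - (s * a 0 i + t * b 0 i).
Proof. by rewrite !mxE. Qed.

Lemma harmonic_approx D (g : R * R -> 'rV[R]_n) z (eta : R) : open D -> harmonic_on D g ->
  D z -> 0 < eta -> \forall w \near z,
    `|g w - g z - ((w - z).1 *: 'D_e_x g z + (w - z).2 *: 'D_e_y g z)| <= eta * `|w - z|.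
Proof.
move=> oD gh Dz eta0.
have Ex i := derive_coordf i (harmonic_derivable (b := false) gh Dz).
have Ey i := derive_coordf i (harmonic_derivable (b := true) gh Dz).
rewrite -/(axis false) -/(axis true).
move: ('D_(axis false) g z) ('D_(axis true) g z) Ex Ey => a b Ex Ey.
have K i : \forall w \near z, `|coordf i g w - coordf i g z -
    ((w - z).1 * a 0 i + (w - z).2 * b 0 i)| <= eta * `|w - z|.
  rewrite Ex Ey.
  by have Q := harmonic_approx_scalar oD ((harmonic_on_coordf g oD).1 gh i) Dz eta0; exact Q.
have {}K := filter_forall (nbhs_filter z) K.
apply: filterS K => w K; apply: norm_le_coord; first by rewrite mulr_ge0 // ltW.
by move=> i; rewrite coord_combination; have Q := K i; exact Q.
Qed.

Lemma harmonic_differentiable D (g : R * R -> 'rV[R]_n) z : open D -> harmonic_on D g -> D z ->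
  differentiable g z /\ forall v, 'd g z v = v.1 *: 'D_e_x g z + v.2 *: 'D_e_y g z.
Proof.
by move=> oD gh Dz; apply: differentiable_approx => eta; exact: harmonic_approx gh Dz.
Qed.

Lemma dotZl (c : R) (u v : 'rV[R]_n) : dot (c *: u) v = c * dot u v.
Proof. by rewrite /dot mulr_sumr; apply: eq_bigr => i _; rewrite mxE mulrA. Qed.

Lemma dotDl (u v w : 'rV[R]_n) : dot (u + v) w = dot u w + dot v w.
Proof. by rewrite /dot -big_split; apply: eq_bigr => i _; rewrite mxE mulrDl. Qed.

Lemma dotC (u v : 'rV[R]_n) : dot u v = dot v u.
Proof. by apply: eq_bigr => i _; rewrite mulrC. Qed.

Lemma dot_ge0 (u : 'rV[R]_n) : 0 <= dot u u.
Proof. by apply: sumr_ge0 => i _; rewrite -expr2 sqr_ge0. Qed.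

Lemma dot_eq0 (u : 'rV[R]_n) : dot u u = 0 -> u = 0.
Proof.
move=> /eqP; rewrite /dot psumr_eq0 => [/allP H|i _]; last by rewrite -expr2 sqr_ge0.
apply/rowP => i; have := H i (mem_index_enum i).
by rewrite mxE /= -expr2 sqrf_eq0 => /eqP.
Qed.

Lemma conformalE (g : R * R -> 'rV[R]_n) z : conformal_at g z <->
  dot ('D_e_x g z) ('D_e_y g z) = 0 /\ dot ('D_e_x g z) ('D_e_x g z) =
    dot ('D_e_y g z) ('D_e_y g z).
Proof.
have sq (a b : R) : 0 <= a -> 0 <= b -> Num.sqrt a = Num.sqrt b -> a = b.
  by move=> a0 b0 E; rewrite -(sqr_sqrtr a0) E sqr_sqrtr.
split=> -[h1 h2]; split.
- exact h1.
- by have Q := sq _ _ (dot_ge0 _) (dot_ge0 _) h2; exact Q.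
- exact h1.
- by have Q := congr1 Num.sqrt h2; exact Q.
Qed.

Lemma orthogonal_free (x y : 'rV[R]_n) (s t : R) : dot x y = 0 -> dot x x = dot y y ->
  x != 0 -> s *: x + t *: y = 0 -> s = 0 /\ t = 0.
Proof.
move=> c1 c2 x0 E.
have xx : dot x x != 0 by apply: contra x0 => /eqP /dot_eq0 ->.
have d0 u : dot (0 : 'rV[R]_n) u = 0 by rewrite -(scale0r 0) dotZl mul0r.
split; apply/eqP.
  have := congr1 (fun w => dot w x) E.
  rewrite d0 dotDl !dotZl (dotC y) c1 mulr0 addr0 => /eqP.
  by rewrite mulf_eq0 (negbTE xx) orbF.
have := congr1 (fun w => dot w y) E.
rewrite d0 dotDl !dotZl c1 mulr0 add0r -c2 => /eqP.
by rewrite mulf_eq0 (negbTE xx) orbF.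
Qed.

(** The two partial derivatives are orthogonal and have the same length, so they
    are independent as soon as one of them is nonzero. *)
Lemma conformal_immersive D (g : R * R -> 'rV[R]_n) z : open D -> harmonic_on D g -> D z ->
  conformal_at g z ->
  immersive_at g z <-> 'D_e_x g z != 0.
Proof.
move=> oD gh Dz /conformalE[c1 c2]; have [gd dE] := harmonic_differentiable oD gh Dz.
split=> [inj|x0].
  apply/eqP => x0; have : e_x = 0 :> R * R.
    by apply: inj; rewrite dE linear0 /= x0 scaler0 scale0r addr0.
  by move=> /(congr1 fst) /eqP; rewrite oner_eq0.
have K v : 'd g z v = 0 -> v = 0.
  rewrite dE => /(orthogonal_free c1 c2 x0)[v1 v2].
  by rewrite [v]surjective_pairing v1 v2.
by move=> v w E; apply/subr0_eq/K; rewrite linearB /= E subrr.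
Qed.

End Vector.

(** * Connectedness of plane balls *)

Lemma dependent_choice_nat (X : Type) (P : nat -> X -> Prop) (Q : nat -> X -> X -> Prop) x0 :
  P 0%N x0 -> (forall j x, P j x -> exists2 y, P j.+1 y & Q j x y) ->
  exists s : nat -> X, [/\ s 0%N = x0, forall j, P j (s j) & forall j, Q j (s j) (s j.+1)].
Proof.
move=> P0 H.
have nx (j : nat) (x : X) : {y | P j x -> P j.+1 y /\ Q j x y}.
  apply: cid; case: (pselect (P j x)) => [/H[y Py Qy]|nP]; first by exists y.
  by exists x.
pose s := fix s j := if j is j'.+1 then projT1 (nx j' (s j')) else x0.
have sP j : P j (s j).
  by elim: j => [//|j IH]; case: (projT2 (nx j (s j)) IH).
exists s; split => // j; by case: (projT2 (nx j (s j)) (sP j)).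
Qed.

Section PlaneConnected.
Context {R : realType}.

(** A union of segments issued from c. *)
Lemma starshaped_connected (V : normedModType R) (A : set V) (c : V) : A c ->
  (forall w, A w -> forall t : R, 0 <= t <= 1 -> A (c + t *: (w - c))) -> connected A.
Proof.
move=> Ac H.
pose S w := (fun t : R => c + t *: (w - c)) @` `[0, 1]%classic.
have -> : A = \bigcup_(w in A) S w.
  apply/seteqP; split=> [w Aw|_ [w Aw [t /= t01 <-]]].
    exists w => //; exists 1; first by rewrite /= in_itv /= ler01 lexx.
    by rewrite scale1r addrC subrK.
  by apply: H => //; move: t01; rewrite in_itv.
apply: bigcup_connected.
  exists c => w Aw; exists 0; first by rewrite /= in_itv /= ler01 lexx.
  by rewrite scale0r addr0.
move=> w Aw; apply: connected_continuous_connected; first exact: segment_connected.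
apply: continuous_subspaceT => t.
by apply: cvgD; [exact: cvg_cst|apply: cvgZl; exact: cvg_id].
Qed.

Lemma ball_convex (V : normedModType R) (z c w : V) (t r : R) : `|c - z| < r -> `|w - z| < r ->
  0 <= t <= 1 -> `|c + t *: (w - c) - z| < r.
Proof.
move=> cr wr /andP[t0 t1].
have -> : c + t *: (w - c) - z = (1 - t) *: (c - z) + t *: (w - z).
  by rewrite scalerBl scale1r -[RHS]addrA [X in _ =
    _ + X]addrC -scalerBr opprB addrA subrK addrAC.
rewrite (le_lt_trans (ler_normD _ _)) // !normrZ (ger0_norm t0) ger0_norm ?subr_ge0 //.
have [->|tn0] := eqVneq t 0; first by rewrite subr0 mul1r mul0r addr0.
have tp : 0 < t by rewrite lt_neqAle eq_sym tn0.
have -> : r = (1 - t) * r + t * r by ring.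
by rewrite ler_ltD // ?ler_wpM2l ?subr_ge0 // ?ltr_pM2l // ltW.
Qed.

Lemma ball_connected (z : R * R) (r : R) : 0 < r -> connected [set w : R * R | `|w - z| < r].
Proof.
move=> r0; apply: (@starshaped_connected _ _ z); first by rewrite /= subrr normr0.
by move=> w wr t t01; apply: ball_convex => //; rewrite subrr normr0.
Qed.

(** Four open half balls cover the punctured ball; each is convex and each meets
    the next one. *)
Lemma punctured_ball_connected (z : R * R) (r : R) : 0 < r ->
  connected [set w : R * R | `|w - z| < r /\ w <> z].
Proof.
move=> r0.
pose H (b s : bool) := [set w : R * R | `|w - z| < r /\
  0 < (-1) ^+ s * (if b then (w - z).2 else (w - z).1)].
pose q (x y : R) : R * R := z + (x * (r / 2), y * (r / 2)).
have r2 : 0 < r / 2 by rewrite divr_gt0.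
have qr x y : `|x| <= 1 -> `|y| <= 1 -> `|q x y - z| < r.
  move=> x1 y1; rewrite /q addrC addKr prod_normE /= gt_max (normrM x) (normrM y)
    (gtr0_norm r2).
  have H1 u : `|u| <= 1 -> `|u| * (r / 2) < r.
    move=> u1; apply: (@le_lt_trans _ _ (1 * (r / 2))); last by lra.
    by rewrite ler_wpM2r // ltW.
  by rewrite !H1.
have qE x y : q x y - z = (x * (r / 2), y * (r / 2)) by rewrite /q addrC addKr.
have Hc b s : connected (H b s).
  pose e : R := (-1) ^+ s; have e1 : `|e| <= 1 by rewrite /e normrX normrN1 expr1n.
  have ee : e * e = 1 by rewrite /e -expr2 sqrr_sign.
  apply: (@starshaped_connected _ _ (if b then q 0 e else q e 0)).
    split; first by case: b; apply: qr; rewrite ?normr0.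
    by rewrite -/e; case: b; rewrite qE /= (mulrA e e) ee mul1r.
  move=> w [wr w0] t t01; split.
    by apply: ball_convex => //; case: b {w0}; apply: qr; rewrite ?normr0.
  rewrite -/e in w0 *; have /andP[t0 t1] := t01.
  have [->|tn0] := eqVneq t 0.
    by rewrite scale0r addr0; case: b {w0}; rewrite qE /= (mulrA e e) ee mul1r.
  have tp : 0 < t by rewrite lt_neqAle eq_sym tn0.
  case: b w0 => /= w0; rewrite /q /= /GRing.scale /=.
    rewrite [X in 0 < X](_ : _ = (1 - t) * (e * e) * (r / 2) + t * (e * (w.2 - z.2)));
      last by ring.
    by rewrite ee mulr1; apply: ltr_wpDl; [rewrite mulr_ge0 ?subr_ge0 ?(ltW r2)|rewrite
      mulr_gt0].
  rewrite [X in 0 < X](_ : _ = (1 - t) * (e * e) * (r / 2) + t * (e * (w.1 - z.1)));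
    last by ring.
  by rewrite ee mulr1; apply: ltr_wpDl; [rewrite mulr_ge0 ?subr_ge0 ?(ltW r2)|rewrite mulr_gt0].
have -> : [set w : R * R | `|w - z| < r /\ w <> z] =
    ((H false false `|` H true false) `|` H false true) `|` H true true.
  apply/seteqP; split=> [w [wr wz]|w]; last first.
    move=> [[[]|]|] [wr w0]; split => // E; move: w0; rewrite E subrr /= ?mulr0 ltxx //.
  have [w1|w1|w1] := ltgtP (w - z).1 0.
  - by left; right; split => //; rewrite expr1 mulN1r oppr_gt0.
  - by left; left; left; split => //; rewrite expr0 mul1r.
  have [w2|w2|w2] := ltgtP (w - z).2 0.
  - by right; split => //; rewrite expr1 mulN1r oppr_gt0.
  - by left; left; right; split => //; rewrite expr0 mul1r.
  case: wz; apply/subr0_eq; rewrite [LHS]surjective_pairing w1 w2 //.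
have n1 : `|1 : R| <= 1 by rewrite normr1.
have n2 : `|-1 : R| <= 1 by rewrite normrN1.
apply: connectedU => //.
- exists (q (-1) (-1)); split; last first.
    by split; [exact: qr|rewrite qE /= expr1 !mulN1r opprK].
  by right; split; [exact: qr|rewrite qE /= expr1 !mulN1r opprK].
apply: connectedU => //.
- exists (q (-1) 1); split; last first.
    by split; [exact: qr|rewrite qE /= expr1 !mulN1r opprK].
  by right; split; [exact: qr|rewrite qE /= expr0 !mul1r].
apply: connectedU => //.
exists (q 1 1); split.
  by split; [exact: qr|rewrite qE /= expr0 !mul1r].
by split; [exact: qr|rewrite qE /= expr0 !mul1r].
Qed.

End PlaneConnected.

(** * Runge sets in surfaces *)

Section SurfaceTopology.
Context {T : topologicalType}.
Implicit Types (A B C K O U V : set T) (p q : T).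

(** All that the study of Runge sets uses of the local structure of a surface:
    small neighbourhoods that are connected, relatively compact, and stay
    connected without their centre. *)
Definition euclidean_base := forall p V, open V -> V p -> exists B C,
  [/\ [/\ open B, B p & connected B], compact C, B `<=` C, C `<=` V & connected (B `\ p)].

Context (base : euclidean_base) (hT : hausdorff_space T).

Lemma component_open O p : open O -> open (connected_component O p).
Proof.
move=> oO; rewrite openE => q pq.
have [B [C [[oB Bq cB] _ BC CO _]]] := base oO (connected_component_sub pq).
apply: filterS (open_nbhs_nbhs (conj oB Bq)).
rewrite (same_connected_component pq).
by apply: connected_component_max => //; exact: subset_trans BC CO.
Qed.

Lemma closed_point p : closed [set p].
Proof. exact/accessible_closed_set1/hausdorff_accessible. Qed.

(** In a separation of O minus p, the connected set B minus p lies on one side;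
    adding p to that side would separate O. *)
Lemma puncture_connected O p : open O -> connected O -> connected (O `\ p).
Proof.
move=> oO cO; have [Op|nOp] := pselect (O p); last first.
  suff -> : O `\ p = O by [].
  by apply/seteqP; split=> [q []|q Oq] //; split => // E; apply: nOp; rewrite -E.
have [B [C [[oB Bp cB] _ BC CO cBp]]] := base oO Op.
apply/connectedP => E [E0 EU sE].
have Bsub : B `\ p `<=` E false `|` E true.
  by rewrite -EU => q [Bq qp]; split => //; exact/CO/BC.
wlog BE : E E0 EU sE Bsub / B `\ p `<=` E false.
  move=> W; have [H|H] := connected_subset sE Bsub cBp; first exact: (W E).
  apply: (W (E \o negb)) => //=.
  - by rewrite EU setUC.
  - by rewrite separatedC.
  - by rewrite setUC.
have pE b : ~ E b p.
  move=> Ep; have : (O `\ p) p by rewrite EU; case: b Ep; [right|left].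
  by case=> _; apply.
have [s1 s2] := sE.
have /connectedP/(_ (fun b => if b then E true else E false `|` [set p])) := cO; apply.
split.
- case; first exact: E0.
  by exists p; right.
- apply/seteqP; split=> q.
    move=> Oq; have [->|qp] := pselect (q = p); first by left; right.
    by have : (O `\ p) q by []; rewrite EU => -[]; [left; left|right].
  case=> [[Eq|->//]|Eq]; first by have [] : (O `\ p) q by rewrite EU; left.
  by have [] : (O `\ p) q by rewrite EU; right.
- split.
    rewrite closureU setIUl s1 set0U -(closure_id _).1; last exact: closed_point.
    by apply/seteqP; split => // q [-> /pE].
  rewrite setIUl s2 set0U; apply/seteqP; split =>
    // q [-> /(_ B (open_nbhs_nbhs (conj oB Bp)))].
  move=> [x [Ex Bx]].
  have xp : x <> p by move=> xp; apply: (pE true); rewrite -xp.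
  have Efx : E false x by apply: BE.
  have : (E false `&` closure (E true)) x by split => //; exact: subset_closure.
  by rewrite s2.
Qed.

(** The new complement contains each old component minus at most one point. What
    is left of the component is connected, and precompact only if the component is. *)
Lemma runge_setU1 K p : closed K -> runge K -> runge (K `|` [set p]).
Proof.
move=> cK rK q /not_orP[Kq qp] pc; apply: (rK q Kq).
have oK : open (~` K) by exact: closed_openC.
have sub : connected_component (~` K) q `\ p `<=` connected_component (~` (K `|` [set p])) q.
  apply: connected_component_max.
  - by split => //; exact: connected_component_refl.
  - by move=> x [/connected_component_sub Kx xp] [].
  - apply: puncture_connected; [exact: component_open|exact: component_connected].
have [D DU [Dc Dcl]] := pc.
exists (D `|` [set p]); last first.
  by split; [apply: compactU => //; exact: compact_set1|apply: closedU => //;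
    exact: closed_point].
move=> x Cx; have [->|xp] := pselect (x = p); first by right.
by left; apply: DU; apply: sub.
Qed.

Lemma runge_finite (a : nat -> T) K (s : seq nat) : closed K -> runge K ->
  closed (K `|` [set a k | k in [set` s]]) /\ runge (K `|` [set a k | k in [set` s]]).
Proof.
move=> cK rK; elim: s => [|k s [IHc IHr]].
  suff -> : [set a k | k in [set` [::]]] = set0 by rewrite setU0.
  by apply/seteqP; split => // x [].
have -> : K `|` [set a k | k in [set` (k :: s)]] =
  (K `|` [set a k | k in [set` s]]) `|` [set a k].
  apply/seteqP; split=> x.
    case=> [Kx|[j /=]]; first by left; left.
    by rewrite inE => /orP[/eqP->|js] <-; [right|left; right; exists j].
  case=> [[Kx|[j js <-]]|->]; [by left|right|right].
    by exists j => //=; rewrite inE js orbT.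
  by exists k => //=; rewrite inE eqxx.
by split; [apply: closedU => //; exact: closed_point|exact: runge_setU1].
Qed.

Lemma seq_union_compact (s : seq T) (f : T -> set T) :
  (forall i, compact (f i)) -> compact (\bigcup_(i in [set` s]) f i).
Proof. by move=> H; rewrite bigcup_seq; apply: bigsetU_compact. Qed.

(** The near-covering property along the directed set of finite sequences of points
    of K. *)
Lemma compact_finite_cover K (f : T -> set T) : compact K ->
  (forall p, K p -> open (f p) /\ f p p) ->
  exists2 s : seq T, (forall i, i \in s -> K i) & K `<=` \bigcup_(i in [set` s]) f i.
Proof.
move=> /compact_near_coveringP cK fK.
pose inK (s : seq T) := forall i, i \in s -> K i.
pose F := filter_from inK (fun s0 => [set s : seq T | {subset s0 <= s} /\ inK s]).
have FF : Filter F.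
  apply: filter_from_filter; first by exists [::].
  move=> s1 s2 k1 k2; exists (s1 ++ s2).
    by move=> i; rewrite mem_cat => /orP[/k1|/k2].
  move=> s [sub sK]; split; split => // i si; apply: sub; first by rewrite mem_cat si.
  by rewrite mem_cat si orbT.
have [|s0 s0K H] := cK _ F (fun s x => (\bigcup_(i in [set` s]) f i) x) FF.
  move=> x Kx; have [ofx fx] := fK x Kx.
  exists (f x, [set s : seq T | {subset [:: x] <= s} /\ inK s]).
    split; first exact: open_nbhs_nbhs.
    by exists [:: x] => // i; rewrite inE => /eqP ->.
  move=> [y s] /= [fy [sub _]]; exists x => //=; apply: sub; exact: mem_head.
by exists s0 => //; apply: H; split.
Qed.

Lemma compact_nbhd K U : compact K -> open U -> K `<=` U -> exists V C,
  [/\ open V, compact C, K `<=` V, V `<=` C & C `<=` U].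
Proof.
move=> cK oU KU.
have bx p : {BC : set T * set T | [/\ open BC.1, compact BC.2, K p -> BC.1 p,
    BC.1 `<=` BC.2 & BC.2 `<=` U]}.
  apply: cid; case: (pselect (K p)) => [Kp|nKp]; last first.
    by exists (set0, set0); split => //=; [exact: open0|exact: compact0].
  have [B [C [[oB Bp cB] cC BC CU _]]] := base oU (KU p Kp).
  by exists (B, C).
pose b p := (projT1 (bx p)).1; pose c p := (projT1 (bx p)).2.
have [p Kp|D DK KD] := @compact_finite_cover K b cK.
  by case: (projT2 (bx p)) => ob _ /(_ Kp).
exists (\bigcup_(i in [set` D]) b i), (\bigcup_(i in [set` D]) c i); split => //.
- by apply: bigcup_open => i _; case: (projT2 (bx i)).
- by apply: seq_union_compact => i; case: (projT2 (bx i)).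
- by apply: subset_bigcup => i _; case: (projT2 (bx i)).
- by move=> x [i _]; case: (projT2 (bx i)) => _ _ _ _; apply.
Qed.

Lemma closed_discrete_finite A K : closed_discrete A -> compact K -> finite_set (A `&` K).
Proof.
move=> [cA iA] cK.
have bx p : {B : set T | [/\ open B, B p & A `&` B `<=` [set p]]}.
  apply: cid; case: (pselect (A p)) => [|nAp]; last first.
    exists (~` A); split => //; first exact: closed_openC.
    by move=> x [].
  rewrite -[X in X p]iA => -[_ [V]]; rewrite nbhsE => -[B [oB Bp] BV] VA.
  exists B; split => // x [Ax Bx]; rewrite -VA; split => //; exact: BV.
have [p Kp|D DK KD] := @compact_finite_cover K (fun p => projT1 (bx p)) cK.
  by case: (projT2 (bx p)).
apply: (@sub_finite_set _ _ [set` D]); last exact: finite_seq.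
move=> x [Ax Kx]; have [i Di Bx] := KD x Kx.
by have [_ _ /(_ x)] := projT2 (bx i); move=> -> //.
Qed.

Context (open_T : forall p, ~ compact (connected_component [set: T] p)).

(** The Runge hull of K, in which the holes of the complement are filled. *)
Definition hull K := K `|` [set p | ~ K p /\ precompact (connected_component (~` K) p)].

Lemma sub_hull K : K `<=` hull K. Proof. by move=> p; left. Qed.

Lemma hull_setC K : ~` hull K = [set p | ~ K p /\ ~ precompact (connected_component (~` K) p)].
Proof.
apply/seteqP; split=> p.
  by move=> /not_orP[Kp /not_andP[]].
by move=> [Kp pc] [//|[_]].
Qed.

Lemma component_sub_hull_setC K p : (~` hull K) p ->
  connected_component (~` K) p `<=` ~` hull K.
Proof.
rewrite hull_setC => -[Kp pc] q pq; split; first exact: connected_component_sub pq.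
by rewrite -(same_connected_component pq).
Qed.

Lemma hull_closed K : closed K -> closed (hull K).
Proof.
move=> cK; rewrite -[hull K]setCK; apply: open_closedC; rewrite openE => p Hp.
have Kp : ~ K p by move: Hp; rewrite hull_setC => -[].
have oC : open (connected_component (~` K) p) by apply: component_open; exact: closed_openC.
apply: filterS (component_sub_hull_setC Hp) _.
by apply: open_nbhs_nbhs; split => //; exact: connected_component_refl.
Qed.

Lemma hull_runge K : runge (hull K).
Proof.
move=> p Hp pc; have := Hp; rewrite hull_setC => -[Kp]; apply.
apply: precompact_subset pc; apply: connected_component_max.
- exact: connected_component_refl.
- exact: component_sub_hull_setC.
- exact: component_connected.
Qed.

Lemma clopen_component G p : open G -> closed G -> connected G -> G p ->
  connected_component [set: T] p = G.
Proof.
move=> oG cG ctG Gp; apply/seteqP; split; last exact: connected_component_max.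
have H : connected_component [set: T] p `&` G = connected_component [set: T] p.
  apply: (component_connected (A := [set: T]) (x := p)).
  - by exists p; split => //; exact: connected_component_refl.
  - by exists G.
  - by exists G.
by rewrite -H => q [].
Qed.

(** Take a compact neighbourhood C of K, containing an open V around K. The compact
    set C minus V meets only finitely many components of the complement of K. A
    precompact component that avoids it without lying in C is closed and open,
    hence a compact component of the whole space, which open_T
    excludes. *)
Lemma hull_compact K : compact K -> compact (hull K).
Proof.
move=> cK; have clK : closed K by exact: compact_closed.
have [V [C [oV cC KV VC _]]] := compact_nbhd cK openT (@subsetT _ K).
have clC : closed C by exact: compact_closed.
have oK : open (~` K) by exact: closed_openC.
have oG p : open (connected_component (~` K) p) by exact: component_open.
have cbd : compact (C `\` V).
  by apply: compact_closedI => //; exact: open_closedC.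
have [p [Cp Vp]|D DK KD] := @compact_finite_cover _ (connected_component (~` K)) cbd.
  by split => //; apply: connected_component_refl => Kp; apply: Vp; exact: KV.
pose f p := if pselect (precompact (connected_component (~` K) p))
  then closure (connected_component (~` K) p) else set0.
have cf p : compact (f p).
  by rewrite /f; case: pselect => [pc|npc] /=; [rewrite -precompactE|exact: compact0].
apply: (@subclosed_compact _ _ (C `|` \bigcup_(i in [set` D]) f i)).
- exact: hull_closed.
- by apply: compactU => //; exact: seq_union_compact.
move=> p [Kp|[Kp pc]]; first by left; apply: VC; exact: KV.
set G := connected_component (~` K) p in pc.
have Gp : G p by exact: connected_component_refl.
have [[x [Gx [Cx Vx]]]|nbd] := pselect (G `&` (C `\` V) !=set0).
  right; have [y Dy yx] := KD x (conj Cx Vx).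
  have E : connected_component (~` K) y = G.
    by rewrite (same_connected_component yx) -(same_connected_component Gx).
  exists y => //; rewrite /f E; case: pselect => [pc'|npc] /=;
    [exact: subset_closure|by case: npc].
left; apply: contrapT => nCp.
have GC : G `&` ~` C = G.
  apply: (component_connected (A := ~` K) (x := p)).
  - by exists p.
  - by exists (~` C) => //; exact: closed_openC.
  - exists (~` V); first exact: open_closedC.
    apply/seteqP; split=> x [Gx nx]; split => //.
      by move=> Vx; apply: nx; exact: VC.
    by move=> Cx; apply: nbd; exists x.
(* G avoids V, hence K, so a limit point of G lies in a component of the
   complement of K, which meets G and is therefore G. *)
have cG : closed G.
  move=> x clx.
  have Kx : ~ K x.
    move=> Kx; have [y [Gy Vy]] := clx V (open_nbhs_nbhs (conj oV (KV x Kx))).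
    by move: Gy; rewrite -GC => -[_]; apply; exact: VC.
  have xx : connected_component (~` K) x x by exact: connected_component_refl.
  have [y [Gy xy]] := clx _ (open_nbhs_nbhs (conj (oG x) xx)).
  apply: connected_component_trans Gy _; exact: connected_component_sym.
apply: (open_T (p := p)).
rewrite (clopen_component (oG p) cG (@component_connected _ _ _) Gp).
by rewrite -precompact_closed.
Qed.

Lemma compact_exhaustion K : @second_countable T -> compact K -> runge K ->
  exists K_ : nat -> set T, [/\ K_ 0%N = K,
    forall j, compact (K_ j) /\ runge (K_ j),
    forall j, K_ j `<=` (K_ j.+1)° & forall p, exists j, K_ j p].
Proof.
move=> [Ba cBa [Bo Bb]] cK rK.
have /countable_injP[f fI] := cBa.
have gx (i : nat) : {b : set T | (exists2 b', Ba b' & f b' = i) -> Ba b /\ f b = i}.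
  apply: cid; case: (pselect (exists2 b', Ba b' & f b' = i)) => [[b Bb' fb]|n].
    by exists b.
  by exists set0.
pose L i := if pselect (precompact (projT1 (gx i))) then closure (projT1 (gx i)) else set0.
have cL i : compact (L i).
  by rewrite /L; case: pselect => [pc|npc] /=; [rewrite -precompactE|exact: compact0].
have Lp p : exists i, L i p.
  have [B [C [[oB Bp cB] cC BC _ _]]] := base openT (I : [set: T] p).
  have [b [bB bp] bsub] := Bb p B (open_nbhs_nbhs (conj oB Bp)).
  exists (f b).
  have [g1 g2] := projT2 (gx (f b)) (ex_intro2 _ _ b bB erefl).
  have E : projT1 (gx (f b)) = b by apply: fI => //; rewrite inE.
  rewrite /L E; case: pselect => [pc|[]] /=; first exact: subset_closure.
  exists C; last by split => //; exact: compact_closed.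
  by move=> x bx; apply: BC; exact: bsub.
have [//|j K' [cK' rK']|K_ [K0 KP KQ]] := @dependent_choice_nat (set T)
    (fun j K' => compact K' /\ runge K') (fun j K' K'' => K' `<=` K''° /\ L j `<=` K'') K.
  have [V [C [oV cC KV VC _]]] := compact_nbhd cK' openT (@subsetT _ K').
  exists (hull (C `|` L j)).
    by split; [apply: hull_compact; apply: compactU|exact: hull_runge].
  split; last by move=> x Lx; apply: sub_hull; right.
  move=> x K'x; apply: filterS (open_nbhs_nbhs (conj oV (KV x K'x))).
  by move=> y Vy; apply: sub_hull; left; exact: VC.
exists K_; split => //; first by move=> j; case: (KQ j).
by move=> p; have [i Li] := Lp p; exists i.+1; case: (KQ i) => _; apply.
Qed.

End SurfaceTopology.

(** * Charts and immersions of surfaces *)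

Section Charts.
Context {R : realType}.

Lemma chart_image_open (M : topologicalType) (phi : chart R M) (U : set M) : open U ->
  open (phi @` (chart_dom phi `&` U)).
Proof.
move=> oU; rewrite openE => _ [q [dq Uq] <-].
have n1 : nbhs (phi q) (phi @` chart_dom phi).
  by apply: open_nbhs_nbhs; split; [exact: chart_img_open|exists q].
have n2 : \forall w \near phi q, U (chart_inv phi w).
  have := chart_inv_continuous (c := phi) (ex_intro2 _ _ q dq erefl :
    (phi @` chart_dom phi) (phi q)).
  apply; rewrite chart_mapK //; apply: open_nbhs_nbhs; split => //.
apply: filterS2 n1 n2 => w [q' dq' <-]; rewrite chart_mapK // => Uq'.
by exists q'.
Qed.

Lemma chart_imageP (M : topologicalType) (phi : chart R M) (U : set M) z :
  (phi @` (chart_dom phi `&` U)) z ->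
  [/\ chart_dom phi (chart_inv phi z), U (chart_inv phi z) & phi (chart_inv phi z) = z].
Proof. by case=> q [dq Uq] <-; rewrite chart_mapK. Qed.

Lemma surface_base (M : conformal_surface R) : @euclidean_base M.
Proof.
move=> p V oV Vp; have [phi _ dp] := atlas_cover p.
set z := phi p.
have oO := chart_image_open (phi := phi) oV.
have [r r0 rO] := open_dist oO (ex_intro2 _ _ p (conj dp Vp) erefl :
  (phi @` (chart_dom phi `&` V)) z).
pose B := chart_inv phi @` [set w | `|w - z| < r / 2].
pose C := chart_inv phi @` [set w | `|w - z| <= r / 2].
have r2 : 0 < r / 2 by rewrite divr_gt0.
have cont (S : set (R * R)) : (forall w, S w -> `|w - z| <= r / 2) ->
  {within S, continuous (chart_inv phi)}.
  move=> H; apply: continuous_in_subspaceT => w; rewrite inE => /H wr.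
  apply: chart_inv_continuous; have [q [dq _] <-] := rO w ltac:(lra).
  by exists q.
have inj w w' : `|w - z| < r -> `|w' - z| < r -> chart_inv phi w = chart_inv phi w' -> w = w'.
  move=> /rO /chart_imageP[_ _ e] /rO /chart_imageP[_ _ e'] E.
  by rewrite -e -e' E.
have zp : chart_inv phi z = p by rewrite chart_mapK.
exists B, C; split.
- split.
  + rewrite openE => _ [w wr <-].
    have [dq _ e] := chart_imageP (rO w ltac:(rewrite /= in wr; lra)).
    have n1 : \forall q \near chart_inv phi w, `|phi q - z| < r / 2.
      have cq := chart_map_continuous dq.
      apply: (cq [set v : R * R | `|v - z| < r / 2]); rewrite /= e; apply: open_nbhs_nbhs;
        split => //.
      have -> : [set w | `|w - z| < r / 2] = ball z (r / 2).
        by apply/seteqP; split=> x; rewrite -ball_normE /= distrC.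
      exact: ball_open.
    have n2 : \forall q \near chart_inv phi w, chart_dom phi q.
      by apply: open_nbhs_nbhs; split => //; exact: chart_dom_open.
    by apply: filterS2 n1 n2 => q qr dq'; exists (phi q) => //; rewrite chart_mapK.
  + by exists z => //=; rewrite subrr normr0.
  + apply: connected_continuous_connected; first exact: ball_connected.
    by apply: cont => w /= /ltW.
- apply: continuous_compact; first by apply: cont.
  have -> : [set w : R * R | `|w - z| <= r / 2] =
      (`[z.1 - r / 2, z.1 + r / 2]%classic `*` `[z.2 - r / 2, z.2 + r / 2]%classic).
    apply/seteqP; split=> w.
      rewrite /= prod_normE ge_max !ler_norml /= !in_itv /= => /andP[h1 h2].
      by split; lra.
    move=> [/=]; rewrite !in_itv /= prod_normE ge_max !ler_norml /= => h1 h2.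
    by apply/andP; split; lra.
  by apply: compact_setX; exact: segment_compact.
- by move=> _ [w wr <-]; exists w => //; exact: ltW.
- by move=> _ [w wr <-]; have [] := chart_imageP (rO w ltac:(rewrite /= in wr; lra)).
- have -> : B `\ p = chart_inv phi @` [set w | `|w - z| < r / 2 /\ w <> z].
    apply/seteqP; split=> [_ [[w wr <-] wp]|_ [w [wr wz] <-]].
      by exists w => //; split => // E; apply: wp; rewrite E zp.
    split; first by exists w.
    move=> E; apply: wz; apply: inj; [lra|by rewrite subrr normr0|by rewrite E].
  apply: connected_continuous_connected; first exact: punctured_ball_connected.
  by apply: cont => w [] /= /ltW.
Qed.

(** Each transition map is differentiable and has a differentiable inverse, so
    its differential is injective. *)
Lemma chart_change_immersive (M : conformal_surface R) n (h : M ->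
  'rV[R]_n) (phi psi : chart R M) x :
  atlas phi -> atlas psi -> chart_dom phi x -> chart_dom psi x ->
  differentiable (h \o chart_inv phi) (phi x) -> differentiable (h \o chart_inv psi) (psi x) ->
  immersive_at (h \o chart_inv phi) (phi x) -> immersive_at (h \o chart_inv psi) (psi x).
Proof.
move=> aphi apsi dphi dpsi d1 d2 im.
have tr (c1 c2 : chart R M) : atlas c1 -> atlas c2 -> chart_dom c1 x -> chart_dom c2 x ->
    differentiable (c2 \o chart_inv c1) (c1 x) /\
    \forall w \near c1 x, chart_inv c2 ((c2 \o chart_inv c1) w) = chart_inv c1 w.
  move=> a1 a2 x1 x2; split.
    have := atlas_conformal a1 a2 (ex_intro2 _ _ x (conj x1 x2) erefl :
      (c1 @` (chart_dom c1 `&` chart_dom c2)) (c1 x)).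
    by case=> /nbhs_singleton [].
  have H := open_nbhs_nbhs (conj (chart_image_open (phi := c1) (chart_dom_open c2))
    (ex_intro2 _ _ x (conj x1 x2) erefl : (c1 @` (chart_dom c1 `&` chart_dom c2)) (c1 x))).
  apply: filterS H => w /chart_imageP[_ w2 _] /=.
  by rewrite chart_mapK.
have [dG _] := tr phi psi aphi apsi dphi dpsi.
have [dF nF] := tr psi phi apsi aphi dpsi dphi.
set F := phi \o chart_inv psi in dF nF; set G := psi \o chart_inv phi in dG.
have Fx : F (psi x) = phi x by rewrite /F /= chart_mapK.
have GF : \forall w \near psi x, (G \o F) w = id w.
  have H := open_nbhs_nbhs (conj (chart_image_open (phi := psi) (chart_dom_open phi))
    (ex_intro2 _ _ x (conj dpsi dphi) erefl :
      (psi @` (chart_dom psi `&` chart_dom phi)) (psi x))).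
  by apply: filterS H => w /chart_imageP[_ w2 e]; rewrite /G /F /= chart_mapK.
have dG' : differentiable G (F (psi x)) by rewrite Fx.
have d1' : differentiable (h \o chart_inv phi) (F (psi x)) by rewrite Fx.
have E1 v : 'd G (phi x) ('d F (psi x) v) = v.
  have e1 := near_eq_derive v GF.
  have e2 := deriveE v (differentiable_comp dF dG').
  have e3 := congr1 (@^~ v) (diff_comp dF dG').
  rewrite /= in e3; rewrite -[in LHS]Fx; rewrite -[RHS](derive_id (psi x) v) -e1 e2.
  exact (esym e3).
have E2 v : 'd (h \o chart_inv psi) (psi x) v =
    'd (h \o chart_inv phi) (F (psi x)) ('d F (psi x) v).
  have nE : \forall w \near psi x, (h \o chart_inv psi) w = ((h \o chart_inv phi) \o F) w.
    by apply: filterS nF => w /= ->.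
  have e1 := near_eq_derive v nE.
  have e2 := deriveE v (differentiable_comp dF d1').
  have e3 := congr1 (@^~ v) (diff_comp dF d1').
  have e4 := deriveE v d2.
  exact (etrans (esym e4) (etrans e1 (etrans e2 e3))).
rewrite Fx in E2.
move=> v w E; have H := im _ _ (etrans (esym (E2 v)) (etrans E (E2 w))).
exact (etrans (esym (E1 v)) (etrans (congr1 _ H) (E1 w))).
Qed.

End Charts.

Section Immersions.
Context {R : realType} {M : conformal_surface R} {n : nat}.
Implicit Types (U : set M) (f : M -> 'rV[R]_n) (Omega : set 'rV[R]_n).

Definition harmonic_conformal U f := forall phi : chart R M, atlas phi ->
  harmonic_on (phi @` (chart_dom phi `&` U)) (f \o chart_inv phi) /\
  forall z, (phi @` (chart_dom phi `&` U)) z -> conformal_at (f \o chart_inv phi) z.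

Definition chart_immersive U f := forall phi : chart R M, atlas phi ->
  forall z, (phi @` (chart_dom phi `&` U)) z -> 'D_e_x (f \o chart_inv phi) z != 0.

(** This separates the conditions that pass to limits from the open ones, which
    need a stability argument. *)
Lemma immersionP U Omega f : open U -> conformal_harmonic_immersion U Omega f <->
  [/\ f @` U `<=` Omega, harmonic_conformal U f & chart_immersive U f].
Proof.
move=> oU; split=> [[im H]|[im H1 H2]].
  split; first exact im.
    move=> phi aphi; have [h1 h2] := H phi aphi; split; first exact h1.
    by move=> z Dz; have [_ h4] := h2 z Dz; exact h4.
  move=> phi aphi z Dz; have [h1 h2] := H phi aphi; have [h3 h4] := h2 z Dz.
  have Q := conformal_immersive (chart_image_open (phi := phi) oU) h1 Dz h4.
  exact (Q.1 h3).
split; first exact im.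
move=> phi aphi; have [h1 h2] := H1 phi aphi; split; first exact h1.
move=> z Dz; split; last by have Q := h2 z Dz; exact Q.
have Q := conformal_immersive (chart_image_open (phi := phi) oU) h1 Dz (h2 z Dz).
exact (Q.2 (H2 phi aphi z Dz)).
Qed.

Lemma chart_image_sub (phi : chart R M) U U' : U' `<=` U ->
  phi @` (chart_dom phi `&` U') `<=` phi @` (chart_dom phi `&` U).
Proof. by move=> UU _ [q [dq Uq] <-]; exists q => //; split => //; exact: UU. Qed.

Lemma immersion_restrict U U' Omega f : U' `<=` U -> conformal_harmonic_immersion U Omega f ->
  conformal_harmonic_immersion U' Omega f.
Proof.
move=> UU [im H]; split; first by move=> _ [p Up <-]; apply: im; exists p => //; exact: UU.
move=> phi aphi; have [h1 h2] := H phi aphi; have sub := chart_image_sub (phi := phi) UU.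
split; first by have Q := harmonic_on_sub sub h1; exact Q.
by move=> z /sub Dz; have Q := h2 z Dz; exact Q.
Qed.

Lemma eq_on_derive_axis D (g1 g2 : R * R -> 'rV[R]_n) : open D -> (forall z, D z ->
  g1 z = g2 z) ->
  forall z, D z -> 'D_e_x g1 z = 'D_e_x g2 z /\ 'D_e_y g1 z = 'D_e_y g2 z.
Proof.
move=> oD E z Dz; split.
  by have H := eq_on_derive false oD E Dz; exact H.
by have H := eq_on_derive true oD E Dz; exact H.
Qed.

Lemma immersion_glue U Omega f : open U ->
  (forall p, U p -> exists U' f', [/\ open U', U' p,
     conformal_harmonic_immersion U' Omega f' & forall q, U' q -> f q = f' q]) ->
  conformal_harmonic_immersion U Omega f.
Proof.
move=> oU H; apply/(immersionP _ _ oU).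
have K (phi : chart R M) z : (phi @` (chart_dom phi `&` U)) z -> atlas phi ->
    exists D' f', [/\ open D', D' z, harmonic_on D' (f' \o chart_inv phi),
     (conformal_at (f' \o chart_inv phi) z /\ 'D_e_x (f' \o chart_inv phi) z != 0) &
    forall w, D' w -> (f \o chart_inv phi) w = (f' \o chart_inv phi) w].
  move=> [p [dp Up] <-] aphi; have [U' [f' [oU' U'p chi E]]] := H p Up.
  have [_ h1 h2] := (immersionP _ _ oU').1 chi.
  have Dz : (phi @` (chart_dom phi `&` U')) (phi p) by exists p.
  have [h3 h4] := h1 phi aphi.
  exists (phi @` (chart_dom phi `&` U')), f'; split.
  - exact: chart_image_open.
  - exact Dz.
  - exact h3.
  - by have q1 := h4 _ Dz; have q2 := h2 phi aphi _ Dz; split; [exact q1|exact q2].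
  - by move=> w /chart_imageP[_ U'w _]; exact: E.
split.
- move=> _ [p Up <-]; have [U' [f' [oU' U'p [im _] E]]] := H p Up.
  by rewrite E //; apply: im; exists p.
- move=> phi aphi; split.
    apply: harmonic_on_local => z Dz; have [D' [f' [oD' D'z h _ E]]] := K phi z Dz aphi.
    exists D'; first exact D'z.
    have Q := harmonic_on_ext oD' (fun w D'w => esym (E w D'w)) h; exact Q.
  move=> z Dz; have [D' [f' [oD' D'z h [c _] E]]] := K phi z Dz aphi.
  have [ex ey] := eq_on_derive_axis oD' E D'z.
  by rewrite /conformal_at ex ey; exact c.
- move=> phi aphi z Dz; have [D' [f' [oD' D'z h [_ c] E]]] := K phi z Dz aphi.
  have [ex _] := eq_on_derive_axis oD' E D'z.
  by rewrite ex; exact c.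
Qed.

Lemma partial_ext i j D (g1 g2 : R * R -> 'rV[R]_n) : open D -> (forall z, D z ->
  g1 z = g2 z) ->
  forall z, D z -> partial i j g1 z = partial i j g2 z.
Proof.
move=> oD E; rewrite /partial; elim: i => [|i IH].
  elim: j => [//|j IH]; have Q := eq_on_derive true oD IH; exact Q.
have Q := eq_on_derive false oD IH; exact Q.
Qed.

Lemma agree_to_order_ext U f1 f2 g1 m p : open U -> U p -> (forall q, U q -> g1 q = f1 q) ->
  agree_to_order m f1 f2 p -> agree_to_order m g1 f2 p.
Proof.
move=> oU Up E H phi aphi dp i j ij; rewrite -(H phi aphi dp i j ij).
apply: (@partial_ext i j (phi @` (chart_dom phi `&` U))); first exact: chart_image_open.
  by move=> z /chart_imageP[_ Uz _]; exact: E.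
by exists p.
Qed.

Lemma agree_to_order_trans f1 f2 f3 m p : agree_to_order m f1 f2 p ->
  agree_to_order m f2 f3 p ->
  agree_to_order m f1 f3 p.
Proof.
by move=> H1 H2 phi aphi dp i j ij; rewrite (H1 phi aphi dp i j ij) (H2 phi aphi dp i j ij).
Qed.

Lemma agree_to_order_le f1 f2 m m' p : (m' <= m)%N -> agree_to_order m f1 f2 p ->
  agree_to_order m' f1 f2 p.
Proof.
by move=> mm H phi aphi dp i j ij; apply: (H phi aphi dp); exact: leq_trans ij mm.
Qed.

Lemma enorm_ge (v : 'rV[R]_n) : `|v| <= enorm v.
Proof.
apply: norm_le_coord; first exact: sqrtr_ge0.
move=> i; rewrite -sqrtr_sqr; apply: ler_wsqrtr.
rewrite /dot (bigD1 i) //= -expr2 lerDl; apply: sumr_ge0 => j _.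
by rewrite -expr2 sqr_ge0.
Qed.

Lemma enorm_le (v : 'rV[R]_n) : enorm v <= n%:R * `|v|.
Proof.
rewrite -[leRHS]ger0_norm ?mulr_ge0 // -sqrtr_sqr; apply: ler_wsqrtr.
apply: (@le_trans _ _ (\sum_(i < n) `|v| ^+ 2)).
  apply: ler_sum => i _; rewrite -expr2 -real_normK ?num_real //.
  by rewrite ler_pXn2r ?nnegrE // coord_le_norm.
rewrite sumr_const card_ord -[_ ^+ 2 *+ n]mulr_natl exprMn ler_wpM2r ?sqr_ge0 //.
by rewrite -natrX ler_nat; case: (n) => // k; rewrite expnS leq_pmulr // expn_gt0.
Qed.

Lemma sup_dist_le (K : set M) f1 f2 (e : R) : (sup_dist K f1 f2 < e%:E)%E ->
  forall p, K p -> `|f1 p - f2 p| <= e.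
Proof.
move=> H p Kp; apply: le_trans (enorm_ge _) _; rewrite -lee_fin; apply: ltW.
by apply: le_lt_trans H; apply: ereal_sup_ubound; exists p.
Qed.

End Immersions.

(** * One step of the construction *)

Section Step.
Context {R : realType} {M : conformal_surface R} {n : nat}.
Implicit Types (f g : M -> 'rV[R]_n).

(** The map equal to g near K and to f near the finitely many points a k of L
    outside K is a conformal harmonic immersion on a neighbourhood of the union
    of K and these points. Adding points to K creates no hole, so flexibility
    applies to this union. *)
Lemma approximation_step (Omega : set 'rV[R]_n) (U0 : set M) f (I : set nat) (a : nat -> M)
    (m : nat -> nat) (K L V : set M) g (delta : R) :
  flexible Omega -> open_surface M -> open U0 -> conformal_harmonic_immersion U0 Omega f ->
  set_inj I a -> closed_discrete (a @` I) -> a @` I `<=` U0 ->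
  compact K -> runge K -> compact L -> open V -> K `<=` V ->
  conformal_harmonic_immersion V Omega g ->
  (forall k, I k -> K (a k) -> agree_to_order (m k) g f (a k)) -> 0 < delta ->
  exists g', [/\ conformal_harmonic_immersion setT Omega g',
    forall k, I k -> L (a k) -> agree_to_order (m k) g' f (a k) &
    forall p, K p -> `|g' p - g p| <= delta].
Proof.
move=> [_ flex] openM oU0 chif inja cda aU0 cK rK cL oV KV chig agr delta0.
have hM := @surface_hausdorff _ M.
have bM := @surface_base R M.
have clK : closed K by exact: compact_closed.
have finS : finite_set (I `&` [set k | L (a k)]).
  have F := closed_discrete_finite cda cL.
  have F' : finite_set (a @` (I `&` [set k | L (a k)])).
    by apply: sub_finite_set F => _ [k [Ik Lk] <-]; split => //; exists k.
  have inj : set_inj (I `&` [set k | L (a k)]) a.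
    by move=> x y /set_mem[xI _] /set_mem[yI _]; apply: inja; exact/mem_set.
  by rewrite -(eq_finite_set (inj_card_eq inj)).
have /finite_seqP[s sE] := finS.
have sP k : k \in s -> I k /\ L (a k).
  by move=> ks; have : [set` s] k by []; rewrite -sE.
have sI k : I k -> L (a k) -> k \in s.
  by move=> Ik Lk; have : [set` s] k by rewrite -sE.
(* The new points; at those already in K the map g has the jets of f. *)
pose s' := [seq k <- s | ~~ `[< K (a k) >]].
pose P := [set a k | k in [set` s']].
have PK p : P p -> ~ K p.
  by move=> [k /=]; rewrite mem_filter => /andP[/asboolPn nK _] <-.
have PU0 : P `<=` U0.
  move=> _ [k /= + <-]; rewrite mem_filter => /andP[_ /sP[Ik _]].
  by apply: aU0; exists k.
have finP : finite_set P by apply: finite_image; exact: finite_seq.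
have cP : compact P by exact: finite_compact.
have clP : closed P by exact: compact_closed.
have [clKP rKP] := runge_finite bM hM a s' clK rK.
rewrite -/P in clKP rKP.
have oVP : open (V `&` ~` P) by apply: openI => //; exact: closed_openC.
have KVP : K `<=` V `&` ~` P by move=> p Kp; split; [exact: KV|move=> Pp; exact: PK Pp Kp].
have [V1 [C1 [oV1 cC1 KV1 V1C1 C1V]]] := compact_nbhd bM cK oVP KVP.
pose W := U0 `&` ~` C1.
have oW : open W by apply: openI => //; apply: closed_openC; exact: compact_closed.
have PW : P `<=` W by move=> p Pp; split; [exact: PU0|move=> /C1V[_]; apply].
pose F p := if pselect (V1 p) then g p else f p.
have F1 p : V1 p -> F p = g p by rewrite /F; case: pselect.
have F2 p : W p -> F p = f p.
  by rewrite /F => -[_ C1p]; case: pselect => // V1p; case: C1p; exact: V1C1.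
have oU' : open (V1 `|` W) by exact: openU.
have chiF : conformal_harmonic_immersion (V1 `|` W) Omega F.
  apply: immersion_glue => // p [V1p|Wp].
    exists (V1 `&` V), g; split; first exact: openI.
    - by split => //; have [] := C1V _ (V1C1 _ V1p).
    - by have Q := immersion_restrict (@subIsetr _ V1 V) chig; exact Q.
    - by move=> q [V1q _]; exact: F1.
  exists W, f; split; [exact oW|exact Wp| |exact F2].
  by have Q := immersion_restrict (@subIsetl _ U0 (~` C1)) chif; exact Q.
have Asub : [set a k | k in [set` s]] `<=` K `|` P.
  move=> _ [k /= ks <-]; have [Ka|Ka] := pselect (K (a k)); first by left.
  right; exists k => //=; rewrite mem_filter ks andbT; exact/asboolPn.
have finA : finite_set [set a k | k in [set` s]] by apply: finite_image; exact: finite_seq.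
have KPU' : K `|` P `<=` V1 `|` W by move=> p [/KV1|/PW]; [left|right].
pose mm := \max_(k <- s) m k.
have [g' [chig' agr' sup']] := flex M (K `|` P) _ (V1 `|` W) F openM
  (compactU cK cP) rKP finA Asub oU' KPU' chiF delta mm delta0.
exists g'; split; first exact chig'.
  move=> k Ik Lk; have ks := sI k Ik Lk.
  have mk : (m k <= mm)%N by exact: leq_bigmax_seq.
  have A1 := agree_to_order_le mk (agr' (a k) (ex_intro2 _ _ k ks erefl)).
  have [Ka|Ka] := pselect (K (a k)).
    apply: agree_to_order_trans A1 _; apply: (agree_to_order_ext oV1 (KV1 _ Ka) F1).
    exact: agr.
  have Pa : P (a k) by exists k => //=; rewrite mem_filter ks andbT; exact/asboolPn.
  apply: agree_to_order_trans A1 _; apply: (agree_to_order_ext oW (PW _ Pa) F2).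
  by move=> phi aphi dp i j ij.
move=> p Kp; rewrite -(F1 p (KV1 _ Kp)).
by apply: sup_dist_le sup' _ _; left.
Qed.
End Step.

(** * Stability of immersions *)

Section Stability.
Context {R : realType} {M : conformal_surface R} {n : nat}.
Implicit Types (f g h : M -> 'rV[R]_n).

Lemma harmonic_conformal_continuous U g p : open U -> harmonic_conformal U g -> U p ->
  {for p, continuous g}.
Proof.
move=> oU hc Up; have [phi aphi dp] := atlas_cover p.
have [h1 _] := hc phi aphi.
have Dz : (phi @` (chart_dom phi `&` U)) (phi p) by exists p.
have c1 := harmonic_on_continuous h1 Dz.
have c2 := chart_map_continuous dp.
have c3 : {for p, continuous ((g \o chart_inv phi) \o phi)}.
  by have Q := @continuous_comp _ _ _ phi (g \o chart_inv phi) p c2 c1; exact Q.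
have nE : \forall q \near p, ((g \o chart_inv phi) \o phi) q = g q.
  have := open_nbhs_nbhs (conj (chart_dom_open phi) dp); apply: filterS => q dq /=.
  by rewrite chart_mapK.
have gp := nbhs_singleton nE.
rewrite /prop_for /continuous_at -gp.
by apply: cvg_trans c3; apply: near_eq_cvg.
Qed.

Lemma image_stable U g (Omega : set 'rV[R]_n) K : open U -> harmonic_conformal U g ->
  open Omega -> g @` U `<=` Omega -> compact K -> K `<=` U ->
  exists2 eta : R, 0 < eta & forall h, (forall p, K p -> `|h p - g p| <= eta) ->
    forall p, K p -> Omega (h p).
Proof.
move=> oU hc oO gO /compact_near_coveringP cK KU.
have := cK _ (0 : R)^'+ (fun eta x => forall v, `|v - g x| <= eta -> Omega v) _.
case=> [p Kp|].
  have [r r0 rO] : exists2 r : R, 0 < r & forall v, `|v - g p| < r -> Omega v.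
    by apply/nbhs_dist; apply: open_nbhs_nbhs; split => //; apply: gO; exists p => //;
      exact: KU.
  have r2 : 0 < r / 2 by rewrite divr_gt0.
  have /cvgrPdist_lt /(_ _ r2) nx := harmonic_conformal_continuous oU hc (KU p Kp).
  exists ([set x | `|g p - g x| < r / 2], [set eta | eta < r / 2]).
    by split => //=; apply: nbhs_right_lt.
  move=> [x eta] /= [gx er] v vx; apply: rO.
  have := ler_distD (g x) v (g p); rewrite (distrC (g x)); lra.
move=> r /= r0 rP; exists (r / 2); first by rewrite divr_gt0.
move=> h hK p Kp.
have r2 : 0 < r / 2 by rewrite divr_gt0.
have nr : `|0 - r / 2| < r by rewrite sub0r normrN gtr0_norm //; lra.
by have Q := rP (r / 2) nr r2 p Kp _ (hK p Kp); exact Q.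
Qed.

(** At a point of C some coordinate of g has in a chart an x-derivative of size
    2 c, which varies by less than c nearby. On a square of radius r / 2 inside K,
    the gradient estimate bounds by c the change of this derivative under a
    harmonic perturbation of size at most c (r / 2) / 3. Compactness of C
    makes this size uniform. The perturbed map is then immersive in every other
    chart, of which there may be infinitely many. *)
Lemma immersion_stable U g K C : open U -> harmonic_conformal U g -> chart_immersive U g ->
  compact K -> K `<=` U -> compact C -> C `<=` K° ->
  exists2 eta : R, 0 < eta & forall h, harmonic_conformal setT h ->
    (forall p, K p -> `|h p - g p| <= eta) -> chart_immersive C h.
Proof.
move=> oU hc im cK KU /compact_near_coveringP cC CK.
have := cC _ (0 : R)^'+ (fun eta x => forall h, harmonic_conformal setT h ->
    (forall p, K p -> `|h p - g p| <= eta) ->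
    forall psi : chart R M, atlas psi -> chart_dom psi x ->
      'D_e_x (h \o chart_inv psi) (psi x) != 0) _.
case=> [p Cp|].
  have [phi aphi dp] := atlas_cover p.
  have [h1 _] := hc phi aphi.
  have Up : U p by apply: KU; apply: interior_subset; exact: CK.
  have Dz : (phi @` (chart_dom phi `&` U)) (phi p) by exists p.
  have im0 := im phi aphi _ Dz.
  have oDU := chart_image_open (phi := phi) oU.
  have [i i0] : exists i, 'D_(axis false) (coordf i (g \o chart_inv phi)) (phi p) != 0.
    apply: contrapT => H; move/eqP: im0; apply; apply/rowP => i; rewrite [RHS]mxE.
    have := derive_coordf i (harmonic_derivable (b := false) h1 Dz) => ->.
    by apply/eqP; apply: contrapT => /negP ne; apply: H; exists i.
  have h1i := (harmonic_on_coordf _ oDU).1 h1 i.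
  set u := coordf i (g \o chart_inv phi) in i0 h1i.
  (* Half the derivative: the other half absorbs its variation near p. *)
  pose c := `|'D_(axis false) u (phi p)| / 2.
  have c0 : 0 < c by rewrite divr_gt0 // normr_gt0.
  have [_ cu _ _] := Ck2_derivable false false h1i.1 Dz.
  have oKi : open K° by exact: open_interior.
  have Dz' : (phi @` (chart_dom phi `&` (K°))) (phi p) by exists p => //; split => //;
    exact: CK.
  have oDK := chart_image_open (phi := phi) oKi.
  have [r1 r10 r1P] := open_dist oDK Dz'.
  have [r2 r20 r2P] : exists2 r2 : R, 0 < r2 & forall w, `|w - phi p| < r2 ->
      `|'D_(axis false) u (phi p) - 'D_(axis false) u w| < c.
    by apply/nbhs_dist; move/cvgrPdist_lt : cu; apply.
  pose r := Num.min r1 r2.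
  have r0 : 0 < r by rewrite lt_min r10.
  have rr1 : r <= r1 by rewrite ge_min lexx.
  have rr2 : r <= r2 by rewrite ge_min lexx orbT.
  have d0 : 0 < r / 2 by rewrite divr_gt0.
  have nx : \forall x \near p, chart_dom phi x /\ `|phi x - phi p| < r / 2.
    have n1 : \forall x \near p, chart_dom phi x.
      by apply: open_nbhs_nbhs; split => //; exact: chart_dom_open.
    have n2 : \forall x \near p, `|phi x - phi p| < r / 2.
      have /cvgrPdist_lt /(_ _ d0) := chart_map_continuous dp.
      by apply: filterS => x; rewrite distrC.
    by apply: filterS2 n1 n2.
  have e0 : 0 < c * (r / 2) / 3 by rewrite divr_gt0 // mulr_gt0.
  exists ([set x | chart_dom phi x /\ `|phi x - phi p| < r / 2], [set eta | eta < c *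
    (r / 2) / 3]).
    by split => //=; apply: nbhs_right_lt.
  move=> [x eta] /= [[dx xr] er] h hh hK psi apsi dpsi.
  have [hh1 hh2] := hh phi aphi.
  have oDT := chart_image_open (phi := phi) (@openT M).
  have h1K : harmonic_on (phi @` (chart_dom phi `&` (K°))) u.
    have sub : phi @` (chart_dom phi `&` (K°)) `<=` phi @` (chart_dom phi `&` U).
      by apply: chart_image_sub => q /interior_subset; exact: KU.
    by have Q := harmonic_on_sub sub h1i; exact Q.
  have hhK : harmonic_on (phi @` (chart_dom phi `&` (K°))) (coordf i (h \o chart_inv phi)).
    have sub : phi @` (chart_dom phi `&` (K°)) `<=` phi @` (chart_dom phi `&` setT).
      exact: chart_image_sub.
    by have Q := harmonic_on_sub sub ((harmonic_on_coordf _ oDT).1 hh1 i); exact Q.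
  have hd := harmonic_onB oDK hhK h1K.
  have xDK : (phi @` (chart_dom phi `&` (K°))) (phi x) by apply: r1P; lra.
  have G : `|'D_(axis false) (coordf i (h \o chart_inv phi) \- u) (phi x)| <= 3 * (c *
    (r / 2) / 3) / (r / 2).
    have HG := @harmonic_gradient R _ _ (phi x) false (r / 2) (c * (r / 2) / 3) hd d0 e0.
    apply HG => w wx.
    have Dw : (phi @` (chart_dom phi `&` (K°))) w.
      apply: r1P; have := ler_distD (phi x) w (phi p); lra.
    split; first exact Dw.
    have [_ Kw _] := chart_imageP Dw.
    have := hK _ (interior_subset Kw) => H1.
    have := coord_le_norm (h (chart_inv phi w) - g (chart_inv phi w)) i.
    rewrite !mxE => H2.
    by rewrite /u /coordf /=; apply: le_trans H2 _; lra.
  have Gc : 3 * (c * (r / 2) / 3) / (r / 2) = c by field; rewrite gt_eqF.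
  rewrite Gc in G.
  have dS := derive_subE xDK (fun w Dw => harmonic_derivable (b := false) hhK Dw)
     (fun w Dw => harmonic_derivable (b := false) h1K Dw).
  rewrite dS in G.
  have ux : `|'D_(axis false) u (phi p) - 'D_(axis false) u (phi x)| < c.
    by apply: r2P; lra.
  have ne : 'D_(axis false) (coordf i (h \o chart_inv phi)) (phi x) != 0.
    apply/negP => /eqP E; rewrite E sub0r normrN in G.
    have T := ler_distD ('D_(axis false) u (phi x)) ('D_(axis false) u (phi p)) 0.
    rewrite !subr0 in T; move: T ux G; rewrite /c; lra.
  have xDT : (phi @` (chart_dom phi `&` setT)) (phi x) by exists x.
  have xDT' : (psi @` (chart_dom psi `&` setT)) (psi x) by exists x.
  have ne' : 'D_e_x (h \o chart_inv phi) (phi x) != 0.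
    apply: contra ne => /eqP E.
    have Q := derive_coordf i (harmonic_derivable (b := false) hh1 xDT).
    have E' := congr1 (fun v : 'rV[R]_n => v 0 i) E; rewrite [RHS]mxE in E'.
    by apply/eqP; exact (etrans (esym Q) E').
  have oDT' := chart_image_open (phi := psi) (@openT M).
  have [hp1 hp2] := hh psi apsi.
  have im1 := (conformal_immersive oDT hh1 xDT (hh2 _ xDT)).2 ne'.
  have [df1 _] := harmonic_differentiable oDT hh1 xDT.
  have [df2 _] := harmonic_differentiable oDT' hp1 xDT'.
  have im2 := chart_change_immersive aphi apsi dx dpsi df1 df2 im1.
  exact ((conformal_immersive oDT' hp1 xDT' (hp2 _ xDT')).1 im2).
move=> r /= r0 rP; exists (r / 2); first by rewrite divr_gt0.
move=> h hh hK psi apsi _ [x [dx Cx] <-].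
have r2 : 0 < r / 2 by rewrite divr_gt0.
have nr : `|0 - r / 2| < r by rewrite sub0r normrN gtr0_norm //; lra.
have Q := rP (r / 2) nr r2 x Cx h hh hK psi apsi dx; exact Q.
Qed.

End Stability.

(** * Limits of approximations *)

Section GeometricLimit.
Context {R : realType} {n : nat} {T : Type}.

Lemma geometric_small (d : nat -> R) (eta : R) : (forall j, 0 < d j) ->
  (forall j, d j.+1 <= d j / 2) -> 0 < eta -> exists N, forall j, (N <= j)%N -> 2 * d j <= eta.
Proof.
move=> d0 dh eta0.
have B j : d j * j.+1%:R <= d 0%N.
  elim: j => [|j IH]; first by rewrite mulr1.
  apply: le_trans IH; have := dh j; have := d0 j.
  rewrite -[j.+2]addn1 -[j.+1]addn1 !natrD => h1 h2.
  have j0 : 0 <= j%:R :> R by rewrite ler0n.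
  have : d j.+1 * (j%:R + 1 + 1) <= d j / 2 * (j%:R + 1 + 1).
    by rewrite ler_wpM2r //; lra.
  have : 0 <= d j * j%:R by rewrite mulr_ge0 // ltW.
  rewrite addn1; lra.
exists (Num.truncn (2 * d 0%N / eta)) => j Nj.
have := truncnS_gt (2 * d 0%N / eta) => H.
have H2 : 2 * d 0%N / eta <= j.+1%:R.
  by apply: ltW; apply: lt_le_trans H _; rewrite ler_nat ltnS.
rewrite ler_pdivrMr // in H2.
have jp : 0 < j.+1%:R :> R by rewrite ltr0n.
rewrite -(ler_pM2r jp) [leRHS]mulrC; apply: le_trans H2.
by rewrite -mulrA ler_wpM2l.
Qed.

Lemma geometric_limit (g : nat -> T -> 'rV[R]_n) (d : nat -> R) (K : nat -> set T) :
  (forall j, 0 < d j) -> (forall j, d j.+1 <= d j / 2) -> (forall j, K j `<=` K j.+1) ->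
  (forall j p, K j p -> `|g j.+1 p - g j p| <= d j) -> (forall p, exists j, K j p) ->
  exists h : T -> 'rV[R]_n, forall j p, K j p -> `|h p - g j p| <= 2 * d j.
Proof.
move=> d0 dh KS gd Kc.
have Kle i j : (i <= j)%N -> K i `<=` K j.
  move=> /subnK <-; elim: (j - i)%N => [//|k IH] p /IH; exact: KS.
have tail j i p : K j p -> (j <= i)%N -> `|g i p - g j p| <= 2 * d j - 2 * d i.
  move=> Kp /subnK <-; elim: (i - j)%N => [|k IH].
    by rewrite add0n !subrr normr0.
  have H := gd (k + j)%N p (Kle _ _ (leq_addl _ _) _ Kp); have h2 := dh (k + j)%N.
  rewrite addSn; apply: le_trans (ler_distD (g (k + j)%N p) _ _) _; lra.
have cv p i : cvg ((fun j => g j p 0 i : R) @ \oo).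
  have [j0 Kp] := Kc p.
  apply/cauchy_cvgP/cauchy_ballP => e e0.
  have [N NP] := geometric_small d0 dh (divr_gt0 e0 (ltr0n R 2)).
  pose N' := maxn N j0.
  pose A := (fun j => g j p 0 i : R) @` [set j | (N' <= j)%N].
  exists (A, A); first by split; exists N' => // j Nj; exists j.
  have B j : (N' <= j)%N -> `|g j p 0 i - g N' p 0 i| < e / 2.
    move=> Nj; have KN : K N' p by apply: Kle Kp; exact: leq_maxr.
    have := tail _ _ _ KN Nj; have := coord_le_norm (g j p - g N' p) i.
    have := NP N' (leq_maxl _ _); have := d0 j; rewrite !mxE; lra.
  move=> [_ _] /= [[j Nj <-] [k Nk <-]].
  have := B j Nj; have := B k Nk; rewrite /ball /= => b1 b2.
  rewrite (splitr e) (le_lt_trans (ler_distD (g N' p 0 i) _ _)) // ltrD //.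
  by rewrite distrC.
exists (fun p => \row_i lim ((fun j => g j p 0 i) @ \oo)) => j p Kp.
apply: norm_le_coord; first by rewrite mulr_ge0 // ltW.
move=> i; rewrite !mxE; apply/ler_addgt0Pr => e e0.
have /cvgrPdist_le /(_ e e0)[N _ NP] := cv p i.
have := NP (maxn N j) (leq_maxl _ _) => /= H1.
have := tail _ _ _ Kp (leq_maxr N j); have := coord_le_norm (g (maxn N j) p - g j p) i.
rewrite !mxE => h2 h3.
have := ler_distD (g (maxn N j) p 0 i) (lim ((fun j => g j p 0 i) @ \oo)) (g j p 0 i).
have := d0 (maxn N j); lra.
Qed.

End GeometricLimit.

Section LimitImmersion.
Context {R : realType} {M : conformal_surface R} {n : nat}.

Lemma geometric_limit_charts (g : nat -> M -> 'rV[R]_n) (h : M -> 'rV[R]_n) (d : nat ->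
  R) (K : nat -> set M) :
  (forall j, 0 < d j) -> (forall j, d j.+1 <= d j / 2) -> (forall j, K j `<=` (K j.+1)°) ->
  (forall p, exists j, K j p) -> (forall j p, K j p -> `|h p - g j p| <= 2 * d j) ->
  forall phi : chart R M,
  lunif_cvg_vec (phi @` (chart_dom phi `&` setT)) (fun j =>
    g j.+1 \o chart_inv phi) (h \o chart_inv phi).
Proof.
move=> d0 dh KS Kc hg phi i z Dz.
have Kle a b : (a <= b)%N -> K a `<=` K b.
  move=> /subnK <-; elim: (b - a)%N => [//|k IH] p /IH /KS; exact: interior_subset.
have [dp _ e] := chart_imageP Dz.
have [j0 Kp] := Kc (chart_inv phi z).
have oKi : open (K j0.+1)° by exact: open_interior.
have oD := chart_image_open (phi := phi) oKi.
have Dz' : (phi @` (chart_dom phi `&` (K j0.+1)°)) z.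
  by exists (chart_inv phi z) => //; split => //; exact: KS.
have [r r0 rP] := open_dist oD Dz'.
exists r => // eta eta0.
have [N NP] := geometric_small d0 dh eta0.
exists (maxn N j0) => j w Nj wr.
have [_ Kw _] := chart_imageP (rP w wr).
have Kw' : K j.+1 (chart_inv phi w).
  apply: (Kle j0.+1); last exact: interior_subset.
  by rewrite ltnS; apply: leq_trans Nj; exact: leq_maxr.
have H1 := hg j.+1 _ Kw'.
have H2 := NP j.+1 (leq_trans (leq_trans (leq_maxl _ _) Nj) (leqnSn _)).
have := coord_le_norm (h (chart_inv phi w) - g j.+1 (chart_inv phi w)) i.
by rewrite !mxE /coordf /= distrC => H3; apply: le_trans H3 _; lra.
Qed.

Lemma limit_harmonic_conformal (g : nat -> M -> 'rV[R]_n) (h : M -> 'rV[R]_n) :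
  (forall j, harmonic_conformal setT (g j)) ->
  (forall phi : chart R M,
    lunif_cvg_vec (phi @` (chart_dom phi `&` setT)) (fun j =>
      g j \o chart_inv phi) (h \o chart_inv phi)) ->
  harmonic_conformal setT h.
Proof.
move=> gh L phi aphi.
have oD := chart_image_open (phi := phi) (@openT M).
have gh1 j := (gh j phi aphi).1.
have [h1 h2] := harmonic_limit_vec oD gh1 (L phi).
split; first exact h1.
move=> z Dz; apply/conformalE.
have c b i := lunif_cvg_pointwise (h2 b i) Dz.
have dotc b b' : (fun j => dot ('D_(axis b) (g j \o chart_inv phi) z) ('D_(axis b')
  (g j \o chart_inv phi) z)) @ \oo
    --> dot ('D_(axis b) (h \o chart_inv phi) z) ('D_(axis b') (h \o chart_inv phi) z).
  rewrite /dot; apply: cvg_big => [|i _]; first by move=> x; exact: add_continuous.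
  by have Q := cvgM (c b i) (c b' i); exact (Q _).
split.
  have E : (fun j => dot ('D_(axis false) (g j \o chart_inv phi) z) ('D_(axis true)
    (g j \o chart_inv phi) z)) = fun=> 0.
    apply/funext => j; have /conformalE[Q _] := (gh j phi aphi).2 z Dz; exact Q.
  have Q := dotc false true; rewrite E in Q.
  have Q1 := cvg_lim (@Rhausdorff R) Q; have Q2 := lim_cst (@Rhausdorff R) (0 : R).
  exact (etrans (esym (Q1 _)) (Q2 _ _ _)).
have E : (fun j => dot ('D_(axis false) (g j \o chart_inv phi) z) ('D_(axis false)
  (g j \o chart_inv phi) z)) =
    (fun j => dot ('D_(axis true) (g j \o chart_inv phi) z) ('D_(axis true)
      (g j \o chart_inv phi) z)).
  apply/funext => j; have /conformalE[_ Q] := (gh j phi aphi).2 z Dz; exact Q.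
have Q := dotc false false; rewrite E in Q.
have Q1 := cvg_lim (@Rhausdorff R) Q; have Q2 := cvg_lim (@Rhausdorff R) (dotc true true).
exact (etrans (esym (Q1 _)) (Q2 _)).
Qed.

Lemma limit_agree (g : nat -> M -> 'rV[R]_n) (h f : M -> 'rV[R]_n) m p N :
  (forall j, harmonic_conformal setT (g j)) ->
  (forall phi : chart R M,
    lunif_cvg_vec (phi @` (chart_dom phi `&` setT)) (fun j =>
      g j \o chart_inv phi) (h \o chart_inv phi)) ->
  (forall j, (N <= j)%N -> agree_to_order m (g j) f p) -> agree_to_order m h f p.
Proof.
move=> gh L agr phi aphi dp i j ij.
have oD := chart_image_open (phi := phi) (@openT M).
have gh1 k := (gh k phi aphi).1.
have P := partial_limit i j oD gh1 (L phi).
have Dz : (phi @` (chart_dom phi `&` setT)) (phi p) by exists p.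
by apply: (lunif_cvg_eventually_cst Dz P) => k Nk; have Q :=
  agr k Nk phi aphi dp i j ij; exact Q.
Qed.

End LimitImmersion.

(** * The theorem *)

Theorem proposition1p2 (R : realType) (n : nat) (hn : (3 <= n)%N)
    (Omega : set 'rV[R]_n) (hOmega : flexible Omega)
    (M : conformal_surface R) (hM : open_surface M)
    (U : set M) (hU : open U)
    (K : set M) (hKU : K `<=` U) (hK : compact K) (hKR : runge K)
    (I : set nat) (a : nat -> M) (ha : set_inj I a)
    (hA : closed_discrete (a @` I)) (hAU : a @` I `<=` U)
    (f : M -> 'rV[R]_n) (hf : conformal_harmonic_immersion U Omega f)
    (eps : R) (heps : 0 < eps) (m : nat -> nat) :
  exists ft : M -> 'rV[R]_n,
    [/\ conformal_harmonic_immersion setT Omega ft,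
        forall k, I k -> agree_to_order (m k) ft f (a k) &
        (sup_dist K f ft < eps%:E)%E].
Proof.
have [[oOmega _ _] _] := hOmega.
have [K_ [K0 KP KS Kc]] := compact_exhaustion (@surface_base R M) (@surface_hausdorff R M)
  hM (@surface_second_countable R M) hK hKR.
have KSS j : K_ j `<=` K_ j.+1 by move=> p /KS; exact: interior_subset.
have Kle i j : (i <= j)%N -> K_ i `<=` K_ j.
  by move=> /subnK <-; elim: (j - i)%N => [//|k IH] p /IH; exact: KSS.
(* Closeness on K_ j controls derivatives only in its interior, so immersivity
   is tracked on the shifted exhaustion. *)
pose C_ j := if j is j'.+1 then K_ j' else set0.
have CP j : compact (C_ j) /\ C_ j `<=` (K_ j)°.
  by case: j => [|j]; split; [exact: compact0|move=> p|case: (KP j)|exact: KS].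
pose stable j (g : M -> 'rV[R]_n) (eta : R) := forall h : M -> 'rV[R]_n,
  (forall p, K_ j p -> `|h p - g p| <= eta) ->
  (forall p, K_ j p -> Omega (h p)) /\ (harmonic_conformal setT h -> chart_immersive (C_ j) h).
have stabilize j (g : M -> 'rV[R]_n) V (B : R) : open V -> K_ j `<=` V ->
    conformal_harmonic_immersion V Omega g -> 0 < B ->
    exists delta : R, [/\ 0 < delta, delta <= B & stable j g (2 * delta)].
  move=> oV KV /(immersionP _ _ oV)[im hc ims] B0.
  have [eta1 e1 H1] := image_stable oV hc oOmega im (KP j).1 KV.
  have [eta2 e2 H2] := immersion_stable oV hc ims (KP j).1 KV (CP j).1 (CP j).2.
  pose e := Num.min B (Num.min (eta1 / 2) (eta2 / 2)).
  have eB : e <= B by rewrite ge_min lexx.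
  have ee1 : e <= eta1 / 2 by rewrite /e !ge_min lexx orbT.
  have ee2 : e <= eta2 / 2 by rewrite /e !ge_min lexx !orbT.
  exists e; split; [by rewrite !lt_min B0 !divr_gt0|exact eB|].
  move=> h hg; split.
    by apply: H1 => p Kp; apply: le_trans (hg p Kp) _; lra.
  by move=> hh; apply: H2 => // p Kp; apply: le_trans (hg p Kp) _; lra.
(* A state is a map together with the tolerance for the next correction. As
   tolerances are at least halved, all later corrections add up to at most
   twice the current one; this is the radius of stability asked for in P. *)
pose St := ((M -> 'rV[R]_n) * R)%type.
pose P j (x : St) := [/\ 0 < x.2,
  exists V, [/\ open V, K_ j `<=` V & conformal_harmonic_immersion V Omega x.1],
  forall k, I k -> K_ j (a k) -> agree_to_order (m k) x.1 f (a k) &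
  stable j x.1 (2 * x.2)].
pose Q j (x y : St) := [/\ forall p, K_ j p -> `|y.1 p - x.1 p| <= x.2,
  y.2 <= x.2 / 2 & conformal_harmonic_immersion setT Omega y.1].
(* enorm is at most n times the sup norm, so this bound on the first
   tolerance keeps the total Euclidean error below eps / 2. *)
have B0 : 0 < eps / (4 * n.+1%:R) by rewrite divr_gt0 // mulr_gt0 // ltr0n.
have [delta0 [d0 dB st0]] := stabilize 0%N f U _ hU (eq_ind_r (fun X => X `<=` U) hKU K0) hf B0.
have P0 : P 0%N (f, delta0).
  split; [exact d0| | |exact st0].
    by exists U; split; [exact hU|rewrite K0; exact hKU|exact hf].
  by move=> k Ik Kk phi aphi dp i j ij.
have PS j x : P j x -> exists2 y, P j.+1 y & Q j x y.
  case: x => g delta [/= del0 [V [oV KV chig]] agr st].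
  have [g' [chig' agr' gg']] := approximation_step hOmega hM hU hf ha hA hAU
    (KP j).1 (KP j).2 (KP j.+1).1 oV KV chig agr del0.
  have [delta' [del0' dd' st']] := stabilize j.+1 g' setT (delta / 2) openT (@subsetT _ _) chig'
    (divr_gt0 del0 (ltr0n R 2)).
  exists (g', delta'); last by split; [exact gg'|exact dd'|exact chig'].
  split; [exact del0'| |exact agr'|exact st'].
  by exists setT; split; [exact: openT|exact: subsetT|exact chig'].
have [s [s0 sP sQ]] := dependent_choice_nat P0 PS.
pose g j := (s j).1; pose d j := (s j).2.
have dpos j : 0 < d j by case: (sP j).
have dhalf j : d j.+1 <= d j / 2 by case: (sQ j).
have gd j p : K_ j p -> `|g j.+1 p - g j p| <= d j by case: (sQ j) => H _ _; exact: H.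
have [ft ftP] := geometric_limit dpos dhalf KSS gd Kc.
have gchi j : conformal_harmonic_immersion setT Omega (g j.+1) by case: (sQ j).
have ghc j : harmonic_conformal setT (g j.+1) by have /(immersionP _ _ openT)[] := gchi j.
have L := geometric_limit_charts dpos dhalf KS Kc ftP.
have fthc : harmonic_conformal setT ft.
  by have H := @limit_harmonic_conformal R M n (fun j => g j.+1) ft ghc L; exact H.
have ftst j : (forall p, K_ j p -> Omega (ft p)) /\ (harmonic_conformal setT ft ->
  chart_immersive (C_ j) ft).
  by case: (sP j) => _ _ _ st; apply: st => p Kp; exact: ftP.
exists ft; split.
- apply/(immersionP _ _ openT); split.
  + by move=> _ [p _ <-]; have [j Kp] := Kc p; exact: (ftst j).1 Kp.
  + exact fthc.
  + move=> phi aphi _ [p [dp _] <-]; have [j Kp] := Kc p.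
    have H := (ftst j.+1).2 fthc phi aphi (phi p); apply H.
    by exists p.
- move=> k Ik; have [j Kk] := Kc (a k).
  have H := @limit_agree R M n (fun j => g j.+1) ft f (m k) (a k) j ghc L; apply H => i ji.
  have Ki : K_ i.+1 (a k) by apply: Kle Kk; exact: leq_trans ji (leqnSn _).
  by case: (sP i.+1) => _ _ agr _; exact: agr.
- have bd p : K p -> enorm (f p - ft p) <= eps / 2.
    move=> Kp; have Kp0 : K_ 0%N p by rewrite K0.
    have := ftP 0%N p Kp0; rewrite /g /d s0 /= distrC => H.
    apply: le_trans (enorm_le _) _.
    have n0 : 0 <= n%:R :> R by rewrite ler0n.
    apply: (@le_trans _ _ (n%:R * (2 * (eps / (4 * n.+1%:R))))).
      by rewrite ler_wpM2l // (le_trans H) // ler_wpM2l.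
    have -> : n%:R * (2 * (eps / (4 * n.+1%:R))) = eps / 2 * (n%:R / n.+1%:R).
      have N0 : (n.+1%:R : R) != 0 by rewrite pnatr_eq0.
      by move: (n.+1%:R : R) N0 => N N0; field.
    apply: ler_piMr; first by rewrite divr_ge0 // ltW.
    by rewrite ler_pdivrMr ?ltr0n // mul1r ler_nat.
  apply: (@le_lt_trans _ _ (eps / 2)%:E); last by rewrite lte_fin; lra.
  by apply: ub_ereal_sup => _ [p Kp <-]; rewrite lee_fin; exact: bd.
Qed.
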